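(* Let $N\subseteq M$ be a (unital) inclusion of von Neumann algebras on a finite-dimensional Hilbert space $H$ with $N$ a factor. Then $$\chi_q(N',M,\mathcal{B}(H))=\chi_{qc}(N',M,\mathcal{B}(H))=[M:N].$$
   Context: A quantum graph is a triple $(\mathcal{S},M,\mathcal{B}(H))$ with $M\subseteq\mathcal{B}(H)$ a von Neumann algebra and $\mathcal{S}\subseteq\mathcal{B}(H)$ a weak* closed operator system which is an $M'$-bimodule. Commutants are taken in $\mathcal{B}(H)$. For $N\subseteq M$, $(N',M,\mathcal{B}(H))$ is a quantum graph. For $H$ finite-dimensional, $L$ a tracial von Neumann algebra (a finite von Neumann algebra with a fixed faithful normal tracial state) and $c\in\mathbb{N}$, the quantum graph $(\mathcal{S},M,\mathcal{B}(H))$ is $(L,c)$ colourable if there is a projection-valued measure $\{P_a\}_{a=1}^c$ in $M\otimes L$ (projections summing to $1$) with $$P_a\big((\mathcal{S}\cap(M')^\perp)\otimes1_L\big)P_a=0,\qquad a=1,\dots,c,$$ where $(M')^\perp$ is the orthogonal complement of $M'$ in $\mathcal{B}(H)$ with respect to the trace (Hilbert--Schmidt) inner product. The quantum commuting chromatic number $\chi_{qc}(\mathcal{S},M,\mathcal{B}(H))$ is the least $c$ such that the quantum graph is $(L,c)$ colourable for some tracial von Neumann algebra $L$; the quantum chromatic number $\chi_q(\mathcal{S},M,\mathcal{B}(H))$ is the least $c$ such that it is $(L,c)$ colourable for some finite-dimensional $L$. $[M:N]$ is the (Watatani) index of the inclusion with respect to its Markov trace $\tau$: if $e_N$ is the orthogonal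 projection of $L^2(M,\tau)$ onto the closure of the image of $N$, then for any finite family $\{\lambda_i\}\subseteq M$ with $\sum_i\lambda_i^*e_N\lambda_i=1$ one has $\sum_i\lambda_i^*\lambda_i=[M:N]1$. (The trace $\tau$ is Markov if the canonical trace $\mathrm{tr}_1$ on $M_1=\langle M,e_N\rangle$ determined by $\mathrm{tr}_1(xe_Ny)=\tau(xy)$ is finite and its normalisation restricts to $\tau$ on $M$.) For a connected inclusion ($Z(N)\cap Z(M)=\mathbb{C}$) of finite-dimensional $C^*$-algebras, $[M:N]=\|\Lambda_N^M\|^2$, the square of the operator norm of the inclusion matrix. *)

(* Defs.v *)
From HB Require Import structures.
From mathcomp Require Import all_boot all_order all_algebra all_field.
From mathcomp Require Import boolp classical_sets reals.
From mathcomp Require Import complex.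

Set Implicit Arguments.
Unset Strict Implicit.
Unset Printing Implicit Defensive.

Import Order.TTheory GRing.Theory Num.Theory.
Import Num.Def FalgLfun.

Local Open Scope ring_scope.
Local Open Scope classical_set_scope.
Local Open Scope complex_scope.
Local Open Scope sesquilinear_scope.

(* Hilbert spaces over C = R[i].  The inner product is linear in its first
   argument; completeness is stated with squared norms '[x] = '[x, x]. *)
Record hilbertSpace (R : realType) := HilbertSpace {
  hs_space :> lmodType R[i];
  hs_dot : {dot hs_space for (@conjC R[i])};
  hs_complete : forall u : nat -> hs_space,
    (forall eps : R, 0 < eps -> exists k : nat, forall p q : nat,
       (k <= p)%N -> (k <= q)%N -> hs_dot (u p - u q) (u p - u q) < eps%:C) ->
    exists l : hs_space, forall eps : R, 0 < eps -> exists k : nat,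
      forall p : nat, (k <= p)%N -> hs_dot (u p - l) (u p - l) < eps%:C
}.

Section Operators.
Variables (R : realType) (K : hilbertSpace R).

Definition bounded_op (T : K -> K) : Prop :=
  linear T /\
  exists B : R, forall x : K, hs_dot K (T x) (T x) <= B%:C * hs_dot K x x.

Definition commutant (A : set (K -> K)) : set (K -> K) :=
  [set T | bounded_op T /\ forall S, A S -> T \o S =1 S \o T].

End Operators.

(* A von Neumann algebra on an arbitrary Hilbert space, presented as a unital
   *-algebra with a faithful unital *-representation whose range equals its
   double commutant.  The last condition forces each [vn_rep x] to be linear
   and bounded; the other ones make [vn_star] a conjugate-linear involution. *)
Record vonNeumannAlgebra (R : realType) := VonNeumannAlgebra {
  vn_alg :> algType R[i];
  vn_star : vn_alg -> vn_alg;
  vn_space : hilbertSpace R;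
  vn_rep : vn_alg -> vn_space -> vn_space;
  vn_rep_linear : forall (a : R[i]) (x y : vn_alg) (xi : vn_space),
    vn_rep (a *: x + y) xi = a *: vn_rep x xi + vn_rep y xi;
  vn_rep_mul : forall (x y : vn_alg) (xi : vn_space),
    vn_rep (x * y) xi = vn_rep x (vn_rep y xi);
  vn_rep_one : forall xi : vn_space, vn_rep 1 xi = xi;
  vn_rep_star : forall (x : vn_alg) (xi eta : vn_space),
    hs_dot _ (vn_rep x xi) eta = hs_dot _ xi (vn_rep (vn_star x) eta);
  vn_rep_inj : injective vn_rep;
  vn_bicommutant : range vn_rep = commutant (commutant (range vn_rep))
}.

Section VonNeumann.
Variables (R : realType) (L : vonNeumannAlgebra R).

Definition vn_le (x y : L) : Prop :=
  forall xi : vn_space L, 0 <= hs_dot _ (vn_rep (y - x) xi) xi.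

Definition vn_is_sup (D : set L) (x : L) : Prop :=
  (forall a, D a -> vn_le a x) /\
  (forall y : L, vn_star y = y -> (forall a, D a -> vn_le a y) -> vn_le x y).

(* Normality: t preserves suprema of bounded upward directed sets of
   self-adjoint elements (that t x bounds t from above on D is positivity). *)
Definition vn_normal (t : L -> R[i]) : Prop :=
  forall (D : set L) (x : L),
    D !=set0 ->
    (forall a, D a -> vn_star a = a) ->
    (forall a b, D a -> D b -> exists c, [/\ D c, vn_le a c & vn_le b c]) ->
    vn_star x = x -> vn_is_sup D x ->
    forall r : R, (forall a, D a -> t a <= r%:C) -> t x <= r%:C.

Definition vn_findim : Prop :=
  exists (k : nat) (b : 'I_k -> L),
    forall x : L, exists a : 'I_k -> R[i], x = \sum_i a i *: b i.

End VonNeumann.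

Record tracialVNA (R : realType) := TracialVNA {
  tva_vn :> vonNeumannAlgebra R;
  tva_tr : {scalar tva_vn};
  tva_tr_unit : tva_tr 1 = 1;
  tva_tr_pos : forall x : tva_vn, 0 <= tva_tr (vn_star x * x);
  tva_tr_faithful : forall x : tva_vn, tva_tr (vn_star x * x) = 0 -> x = 0;
  tva_tr_tracial : forall x y : tva_vn, tva_tr (x * y) = tva_tr (y * x);
  tva_tr_normal : vn_normal tva_tr
}.

(* Von Neumann algebras on the nonzero finite-dimensional space C^(n+1); every
   subspace of matrices is weak operator closed. *)
Record fdVNA (R : realType) (n : nat) := FdVNA {
  fd_carrier :> {aspace 'M[R[i]]_n.+1};
  fd_one : 1 \in fd_carrier;
  fd_star : forall x, x \in fd_carrier -> x ^t* \in fd_carrier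
}.

Definition is_factor (R : realType) (n : nat) (N : fdVNA R n) : Prop :=
  'Z(N)%VS = 1%VS.

(* Here too, weak* closedness of the operator system is automatic. *)
Record quantumGraph (R : realType) (n : nat) := QuantumGraph {
  qg_S : {vspace 'M[R[i]]_n.+1};
  qg_M : fdVNA R n;
  qg_one : 1 \in qg_S;
  qg_star : forall x, x \in qg_S -> x ^t* \in qg_S;
  qg_bimod : forall a x b, a \in 'C(qg_M)%VS -> x \in qg_S ->
    b \in 'C(qg_M)%VS -> a * x * b \in qg_S
}.

Section CommutantGraph.
Variables (R : realType) (n : nat) (N M : fdVNA R n).
Hypothesis sNM : (N <= M)%VS.

Lemma commutant_star (x : 'M[R[i]]_n.+1) :
  x \in 'C(N)%VS -> x ^t* \in 'C(N)%VS.
Proof.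
move=> /centvP xC; apply/centvP => y Ny.
have sM (a b : 'M[R[i]]_n.+1) : (a * b) ^t* = b ^t* * a ^t*.
  by rewrite -[a * b]/(a *m b) trmx_mul map_mxM.
have := congr1 (fun z : 'M[R[i]]_n.+1 => z ^t*) (xC _ (fd_star Ny)).
by rewrite !sM trmxCK => ->.
Qed.

Lemma commutant_bimod (a x b : 'M[R[i]]_n.+1) :
  a \in 'C(M)%VS -> x \in 'C(N)%VS -> b \in 'C(M)%VS ->
  a * x * b \in 'C(N)%VS.
Proof.
move=> /centvP aC xC /centvP bC.
have sub z : (forall y, y \in M -> y * z = z * y) -> z \in 'C(N)%VS.
  by move=> zC; apply/centvP => y Ny; apply/esym/zC/(subvP sNM).
by rewrite -['C(N)%VS]/(asval 'C(N)%AS) !memvM //; apply: sub => y /[dup] My;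
  [move/aC | move/bC].
Qed.

Lemma commutant_one : (1 : 'M[R[i]]_n.+1) \in 'C(N)%VS.
Proof. by apply/centvP => y _; rewrite mul1r mulr1. Qed.

Definition commutant_graph : quantumGraph R n :=
  QuantumGraph commutant_one commutant_star commutant_bimod.

End CommutantGraph.

Section Colouring.
Variables (R : realType) (n : nat) (G : quantumGraph R n) (L : tracialVNA R).

(* B(C^(n+1)) (x) L is the algebra of (n+1) x (n+1) matrices over L. *)
Definition tens (x : 'M[R[i]]_n.+1) (l : L) : 'M[L]_n.+1 :=
  map_mx (fun z => z *: l) x.

Definition adjL (P : 'M[L]_n.+1) : 'M[L]_n.+1 := map_mx (@vn_star R L) P^T.

(* For finite-dimensional M the tensor product is the algebraic one. *)
Definition in_tensor (M : {vspace 'M[R[i]]_n.+1}) (P : 'M[L]_n.+1) : Prop :=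
  exists (k : nat) (m : 'I_k -> 'M[R[i]]_n.+1) (l : 'I_k -> L),
    (forall i, m i \in M) /\ P = \sum_i tens (m i) (l i).

Definition hs_orthogonal (V : {vspace 'M[R[i]]_n.+1}) (x : 'M[R[i]]_n.+1) :=
  forall y, y \in V -> \tr (y ^t* *m x) = 0.

Definition colourable (c : nat) : Prop :=
  exists P : 'I_c -> 'M[L]_n.+1,
    [/\ forall a, in_tensor (qg_M G) (P a),
        forall a, P a *m P a = P a /\ adjL (P a) = P a,
        \sum_a P a = 1%:M
      & forall a x, x \in qg_S G -> hs_orthogonal 'C(qg_M G)%VS x ->
          P a *m tens x 1 *m P a = 0].

End Colouring.

Definition is_least (A : nat -> Prop) (c : nat) : Prop :=
  A c /\ forall c', A c' -> (c <= c')%N.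

Definition is_chi_qc (R : realType) (n : nat) (G : quantumGraph R n) :=
  is_least (fun c => exists L : tracialVNA R, colourable G L c).

Definition is_chi_q (R : realType) (n : nat) (G : quantumGraph R n) :=
  is_least (fun c => exists L : tracialVNA R, vn_findim L /\ colourable G L c).

(* Watatani index.  L^2(M, tau) is M itself with inner product
   <x, y> = tau (y^* x); B(L^2(M, tau)) is 'End(subvs_of M), in which M acts by
   left multiplications amull x. *)
Section Index.
Variables (R : realType) (n : nat) (N M : fdVNA R n).
Local Notation Ms := (subvs_of M).

Definition starM (x : Ms) : Ms := vsproj M ((vsval x) ^t*).

Definition l2dot (tau : {scalar Ms}) (x y : Ms) : R[i] := tau (starM y * x).

Definition faithful_tracial_state (tau : {scalar Ms}) : Prop :=
  [/\ tau 1 = 1,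
      forall x, 0 <= l2dot tau x x,
      forall x, l2dot tau x x = 0 -> x = 0
    & forall x y, tau (x * y) = tau (y * x)].

Definition jones_projection (tau : {scalar Ms}) (e : 'End(Ms)) : Prop :=
  (forall x, vsval (e x) \in N) /\
  (forall x y, vsval y \in N -> l2dot tau (x - e x) y = 0).

Definition basic_construction (e : 'End(Ms)) : {vspace 'End(Ms)} :=
  <<limg (linfun (@amull _ Ms)); e>>%VS.

(* The canonical trace on M_1 = <M, e_N>, given by a functional on the whole of
   B(L^2(M, tau)) of which only the values on M_1 matter. *)
Definition canonical_trace (tau : {scalar Ms}) (e : 'End(Ms))
    (tr1 : {scalar 'End(Ms)}) : Prop :=
  [/\ forall S T, S \in basic_construction e -> T \in basic_construction e ->
        tr1 (S \o T)%VF = tr1 (T \o S)%VF,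
      forall S T, S \in basic_construction e -> T \in basic_construction e ->
        (forall x y, l2dot tau (S x) y = l2dot tau x (T y)) ->
        0 <= tr1 (T \o S)%VF
    & forall x y : Ms, tr1 (amull x \o e \o amull y)%VF = tau (x * y)].

Definition markov_trace (tau : {scalar Ms}) (e : 'End(Ms)) : Prop :=
  [/\ faithful_tracial_state tau, jones_projection tau e
    & exists tr1 : {scalar 'End(Ms)},
        [/\ canonical_trace tau e tr1, 0 < tr1 \1%VF
          & forall x : Ms, tr1 (amull x) / tr1 \1%VF = tau x]].

Definition index_family (e : 'End(Ms)) (k : nat) (lam : 'I_k -> Ms) : Prop :=
  (\sum_i (amull (starM (lam i)) \o e \o amull (lam i)))%VF = \1%VF.

(* The quantification over all Markov traces makes their uniqueness (as far as
   the index is concerned) part of the assertion that [M:N] = d. *)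
Definition is_index (d : R) : Prop :=
  (exists tau e, markov_trace tau e) /\
  forall tau e, markov_trace tau e ->
    (exists (k : nat) (lam : 'I_k -> Ms), index_family e lam) /\
    (forall (k : nat) (lam : 'I_k -> Ms), index_family e lam ->
       \sum_i starM (lam i) * lam i = d%:C *: 1).

End Index.

(* Main.v *)
From HB Require Import structures.
Require Import Defs.
From mathcomp Require Import all_boot all_order all_algebra all_field.
From mathcomp Require Import cyclic.
From mathcomp Require Import boolp classical_sets reals.
From mathcomp Require Import complex.
From mathcomp Require Import ring lra.

Set Implicit Arguments.
Unset Strict Implicit.
Unset Printing Implicit Defensive.

Import Order.TTheory GRing.Theory Num.Theory.
Import Num.Def FalgLfun.

Local Open Scope complex_scope.
Local Open Scope classical_set_scope.
Local Open Scope ring_scope.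
Local Open Scope sesquilinear_scope.

(** Let Q be the relative commutant of N in M.  All three numbers equal dim Q.  (If N is
    a d x d matrix algebra then M is N (x) Q, and with Q a sum of full matrix algebras
    of sizes q_i, the inclusion matrix is the column of the q_i.)

    Instead of decomposing N, the proof uses frames.  A frame of a matrix algebra A
    with a faithful trace tau is a family b_j in A with x = sum_j tau(b_j^* x) b_j for
    all x in A; the twirl m |-> sum_j b_j m b_j^* then takes its values in the
    commutant A' ([twirl_comm]).  For a factor N every m can be recovered from twirls
    of multiples of m ([factor_resolution]), which shows that N and Q generate M, and
    that N and N' generate all matrices ([comm_generated], [comm_factor_commutant]).

    Lower bound ([colouring_lower_bound]).  The compression of x in N' by a
    colour projection P in M (x) L depends only on the expectation of x on M', which
    is a twirl over Q.  Feeding a frame of N' into this identity shows that the slice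
    p of P by the regular trace of Q is a projection.  Hence it has trace at most 1.
    The slices of all colour projections add up to the slice of 1, which is dim Q.

    Colouring with dim Q colours in finite dimension ([bell_colouring]).  Matrix
    units of Q come from minimal projections ([matrix_units_exist]); these exist
    because every right ideal of Q contains a projection that is a left unit for it.
    A block of size q receives q^2 colours, whose projections are amplifications of the
    Bell projections onto q^2 maximally entangled vectors; they fit into Q (x) L for a
    full matrix algebra L whose size is divisible by all block sizes.

    Index ([markov_index], [markov_trace_exists]).  For any Markov trace tau the sum
    attached to an index family is tr_1(1), independently of the family.  A tau-frame
    of Q gives such a family, whose sum has trace dim Q.  The normalised trace of left
    multiplications on M is a Markov trace, the trace on M_1 being the trace of
    endomorphisms of M divided by dim N. *)

(** * The adjoint and the trace of a matrix *)
Section Star.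
Variables (R : realType) (n : nat).
Local Notation C := R[i].
Local Notation Mx := 'M[C]_n.+1.
Implicit Types (a : C) (x y m : Mx).

Lemma starM_mx x y : (x * y) ^t* = y ^t* * x ^t*.
Proof. by rewrite -[x * y]/(x *m y) trmx_mul map_mxM. Qed.

Lemma starD x y : (x + y) ^t* = x ^t* + y ^t*.
Proof. by rewrite linearD /= map_mxD. Qed.

Lemma starB x y : (x - y) ^t* = x ^t* - y ^t*.
Proof. by rewrite linearB /= map_mxB. Qed.

Lemma starZ a x : (a *: x) ^t* = a^* *: x ^t*.
Proof. by rewrite linearZ /= map_mxZ. Qed.

Lemma star0 : (0 : Mx) ^t* = 0.
Proof. by rewrite trmx0 map_mx0. Qed.

Lemma star1 : (1 : Mx) ^t* = 1.
Proof. by rewrite -[1]/(1%:M) tr_scalar_mx map_scalar_mx /= conjC1. Qed.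

Lemma star_sum I (r : seq I) P (F : I -> Mx) :
  (\sum_(i <- r | P i) F i) ^t* = \sum_(i <- r | P i) (F i) ^t*.
Proof. exact: (big_morph (fun x : Mx => x ^t*) starD star0). Qed.

Lemma mxtrace_star x : \tr (x ^t*) = (\tr x)^*.
Proof.
by rewrite [LHS]/mxtrace rmorph_sum; apply: eq_bigr => i _; rewrite !mxE.
Qed.

Lemma mxtrace_starM_ge0 x : 0 <= \tr (x ^t* * x).
Proof.
apply: sumr_ge0 => i _; rewrite -[_ * x]/(_ *m x) mxE; apply: sumr_ge0 => j _.
by rewrite !mxE mulrC mul_conjC_ge0.
Qed.

Lemma mxtrace_starM_eq0 x : \tr (x ^t* * x) = 0 -> x = 0.
Proof.
have ge0 i j : 0 <= (x ^t*) i j * x j i.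
  by rewrite !mxE mulrC mul_conjC_ge0.
move/eqP; rewrite psumr_eq0 => [/allP t0|i _]; last first.
  by rewrite -[_ * x]/(_ *m x) mxE; apply: sumr_ge0.
apply/matrixP => j i; rewrite mxE.
have := t0 i (mem_index_enum _); rewrite -[_ * x]/(_ *m x) mxE psumr_eq0 //.
move=> /allP/(_ j (mem_index_enum _)); rewrite !mxE mulrC mul_conjC_eq0.
by move/eqP.
Qed.

Lemma mxtraceM x y : \tr (x * y) = \tr (y * x).
Proof. exact: mxtrace_mulC. Qed.
End Star.

(** * Frames of matrix algebras *)
Section Frames.
Variables (R : realType) (n : nat).
Local Notation C := R[i].
Local Notation Mx := 'M[C]_n.+1.
Implicit Types (a : C) (x y m : Mx) (A : fdVNA R n) (U : {vspace Mx}).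

(** The functional is defined on all matrices so that sums and products need no
    subtype; only its behaviour on [A] is constrained. *)
Record faithful_trace A (tau : {scalar Mx}) : Prop := FaithfulTrace {
  ftr_star : forall x, x \in A -> tau (x ^t*) = (tau x)^*;
  ftr_ge0 : forall x, x \in A -> 0 <= tau (x ^t* * x);
  ftr_eq0 : forall x, x \in A -> tau (x ^t* * x) = 0 -> x = 0;
  ftr_comm : forall x y, x \in A -> y \in A -> tau (x * y) = tau (y * x) }.

Lemma mxtrace_faithful A : faithful_trace A (@mxtrace C n.+1).
Proof.
split=> *; [exact: mxtrace_star | exact: mxtrace_starM_ge0 |
  exact: mxtrace_starM_eq0 | exact: mxtraceM].
Qed.

Lemma faithful_traceS A (B : fdVNA R n) tau : (A <= B)%VS -> faithful_trace B tau ->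
  faithful_trace A tau.
Proof.
move=> /subvP AB [t1 t2 t3 t4]; split=> [x xA|x xA|x xA|x y xA yA].
- exact/t1/AB.
- exact/t2/AB.
- exact/t3/AB.
- by apply: t4; apply: AB.
Qed.

(** A Parseval frame for the form [tau (y ^t* * x)].  Unlike orthonormality, the
    expansion formula says what is needed about sums over a basis, and it is
    inherited by the family of adjoints. *)
Definition frame (tau : {scalar Mx}) U (o : seq Mx) : Prop :=
  {in o, forall b, b \in U} /\
  forall x, x \in U -> x = \sum_(b <- o) tau (b ^t* * x) *: b.

Lemma fdM A x y : x \in A -> y \in A -> x * y \in A.
Proof. exact: memvM. Qed.

Lemma scalar_subZ (tau : {scalar Mx}) y x a v :
  tau (y * (x - a *: v)) = tau (y * x) - a * tau (y * v).
Proof. by rewrite mulrBr -scalerAr linearB linearZ. Qed.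

(** Gram--Schmidt orthogonalisation: normalise some nonzero [u] in [U], and recurse
    in the orthogonal complement of [u] in [U]. *)
Lemma frame_exists A tau U : faithful_trace A tau -> (U <= A)%VS ->
  exists o, frame tau U o.
Proof.
move=> tauA; have [k] := ubnP (\dim U); elim: k U => // k IH U dimU UA.
have [U0|[u uU u0]] : U = 0%VS \/ exists2 u, u \in U & u != 0.
  case: (eqVneq U 0%VS) => [->|U0]; first by left.
  by right; exists (vpick U); rewrite ?memv_pick // vpick0.
  exists [::]; split=> // x; rewrite U0 memv0 big_nil => /eqP //.
have uA := subvP UA _ uU.
pose s := sqrtC (tau (u ^t* * u)).
have s0 : s != 0.
  by rewrite sqrtC_eq0; apply: contraNneq u0 => /(ftr_eq0 tauA uA) ->.
have sR : (s^-1)^* = s^-1.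
  by apply/CrealP/ger0_real; rewrite invr_ge0 sqrtC_ge0 (ftr_ge0 tauA).
pose v := s^-1 *: u.
have vU : v \in U by rewrite memvZ.
have vA := subvP UA _ vU.
have v1 : tau (v ^t* * v) = 1.
  rewrite /v starZ -scalerAl -scalerAr !linearZ /= sR.
  by rewrite -[tau _]sqrtCK -/s expr2 mulKf ?mulVf.
(* The recursion takes place in the kernel of this functional. *)
have phi_lin : linear (fun x => tau (v ^t* * x) : C^o).
  by move=> a x y; rewrite mulrDr -scalerAr linearP.
pose phiL := GRing.isLinear.Build _ _ _ _ _ phi_lin.
pose phi : {linear Mx -> C^o} := HB.pack (fun x => tau (v ^t* * x) : C^o) phiL.
have kerE x : x \in lker (linfun phi) = (tau (v ^t* * x) == 0).
  by rewrite memv_ker lfunE.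
have vK : v \notin lker (linfun phi) by rewrite kerE v1 oner_eq0.
have [||o [oU' oE]] := IH (U :&: lker (linfun phi))%VS.
- rewrite -(ltn_add2r 1) !addn1; apply: leq_trans dimU; rewrite ltnS.
  rewrite ltn_neqAle dimvS ?capvSl // andbT; apply: contra vK => /eqP dimE.
  have := eqEdim (U :&: lker (linfun phi)) U.
  rewrite capvSl dimE leqnn => /eqP UE.
  by move: vU; rewrite -UE => /memv_capP[].
- exact: subv_trans (capvSl _ _) UA.
exists (v :: o); split=> [b|x xU].
  by rewrite inE => /predU1P[->|/oU'/memv_capP[]].
have xK : x - tau (v ^t* * x) *: v \in (U :&: lker (linfun phi))%VS.
  rewrite memv_cap memvB ?memvZ //= kerE scalar_subZ.
  by rewrite v1 mulr1 subrr.
rewrite big_cons -[LHS](subrK (tau (v ^t* * x) *: v)) addrC; congr (_ + _).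
rewrite [LHS]oE //; apply: eq_big_seq => b bo.
have /memv_capP[bU] := oU' _ bo; rewrite kerE => /eqP vb.
rewrite scalar_subZ.
have -> : tau (b ^t* * v) = 0.
  have bA := subvP UA _ bU.
  by rewrite -[v]trmxCK -starM_mx (ftr_star tauA) ?vb ?conjC0 // fdM ?fd_star.
by rewrite mulr0 subr0.
Qed.
End Frames.

Section Twirl.
Variables (R : realType) (n : nat).
Local Notation C := R[i].
Local Notation Mx := 'M[C]_n.+1.
Implicit Types (a : C) (x y m : Mx) (A : fdVNA R n) (U : {vspace Mx}).
Implicit Types (tau : {scalar Mx}) (o : seq Mx).

(** The Casimir element of the frame, acting on [m]. *)
Definition twirl o m : Mx := \sum_(b <- o) b * m * b ^t*.

Lemma ftr_comm_star A tau x y : faithful_trace A tau -> x \in A -> y \in A ->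
  (tau (x ^t* * y))^* = tau (y ^t* * x).
Proof.
by move=> t xA yA; rewrite -(ftr_star t) ?fdM ?fd_star // starM_mx trmxCK.
Qed.

(** Expanding [x * b] in the frame moves the coefficients to the right-hand factors,
    where they resum to an expansion of the adjoint of [c] times [x]. *)
Lemma twirl_comm A tau o m x : faithful_trace A tau -> frame tau A o -> x \in A ->
  x * twirl o m = twirl o m * x.
Proof.
move=> t [oA oE] xA; rewrite /twirl mulr_sumr mulr_suml.
pose F b c := tau (c ^t* * (x * b)) *: (c * m * b ^t*).
transitivity (\sum_(b <- o) \sum_(c <- o) F b c).
  apply: eq_big_seq => b bo; rewrite !mulrA {1}[x * b]oE ?fdM ?(oA b bo) //.
  rewrite !mulr_suml; apply: eq_bigr => c _.
  by rewrite -!scalerAl.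
rewrite exchange_big; apply: eq_big_seq => c co /=.
have cx : x ^t* * c \in A by rewrite fdM ?fd_star ?(oA c co).
have -> : c * m * c ^t* * x = c * m * (x ^t* * c) ^t*.
  by rewrite starM_mx trmxCK mulrA.
rewrite [x ^t* * c]oE // star_sum mulr_sumr; apply: eq_big_seq => b bo.
rewrite starZ -scalerAr /F (ftr_comm_star t (oA b bo) cx) starM_mx trmxCK.
by rewrite mulrA.
Qed.

Lemma frame_star A tau o : faithful_trace A tau -> frame tau A o ->
  frame tau A [seq b ^t* | b <- o].
Proof.
move=> t [oA oE]; split=> [_ /mapP[b bo ->]|x xA]; first by rewrite fd_star ?oA.
rewrite big_map -{1}[x]trmxCK [x ^t*]oE ?fd_star // star_sum.
apply: eq_big_seq => b bo; rewrite starZ trmxCK (ftr_comm_star t (oA b bo)) ?fd_star //.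
by rewrite trmxCK (ftr_comm t) ?(oA b bo).
Qed.

Lemma twirl_star o m : twirl [seq b ^t* | b <- o] m =
  \sum_(b <- o) b ^t* * m * b.
Proof. by rewrite /twirl big_map; apply: eq_bigr => b _; rewrite trmxCK. Qed.

(** The frame expression of the trace of a linear endomorphism of [U] depends neither
    on the frame nor on the form, and it is cyclic: expand [T b] in the second
    frame and [S c] in the first. *)
Lemma frame_trace_cyclic tau1 tau2 U o1 o2 (S T : {linear Mx -> Mx}) :
  frame tau1 U o1 -> frame tau2 U o2 ->
  {in U, forall x, S x \in U} -> {in U, forall x, T x \in U} ->
  \sum_(b <- o1) tau1 (b ^t* * S (T b)) = \sum_(c <- o2) tau2 (c ^t* * T (S c)).
Proof.
move=> [o1U o1E] [o2U o2E] SU TU.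
pose F b c := tau2 (c ^t* * T b) * tau1 (b ^t* * S c).
transitivity (\sum_(b <- o1) \sum_(c <- o2) F b c).
  apply: eq_big_seq => b bo; rewrite [in LHS](o2E (T b)) ?TU ?o1U //.
  rewrite linear_sum mulr_sumr linear_sum; apply: eq_bigr => c _.
  by rewrite linearZ -scalerAr linearZ.
rewrite exchange_big; apply: eq_big_seq => c co /=.
rewrite [in RHS](o1E (S c)) ?SU ?o2U //.
rewrite linear_sum mulr_sumr linear_sum; apply: eq_bigr => b _.
by rewrite linearZ -scalerAr scalarZ mulrC.
Qed.

Lemma frame_trace_eq tau1 tau2 U o1 o2 (S : {linear Mx -> Mx}) :
  frame tau1 U o1 -> frame tau2 U o2 -> {in U, forall x, S x \in U} ->
  \sum_(b <- o1) tau1 (b ^t* * S b) = \sum_(c <- o2) tau2 (c ^t* * S c).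
Proof.
by move=> f1 f2 SU; apply: (frame_trace_cyclic (T := idfun) f1 f2).
Qed.

(** This number is the trace of the identity of [U], that is its dimension. *)
Lemma frame_size tau1 tau2 U o1 o2 : frame tau1 U o1 -> frame tau2 U o2 ->
  \sum_(b <- o1) tau1 (b ^t* * b) = \sum_(c <- o2) tau2 (c ^t* * c).
Proof. by move=> f1 f2; apply: (frame_trace_eq (S := idfun) f1 f2). Qed.

Lemma frame_unit A tau o : faithful_trace A tau -> frame tau A o ->
  \sum_(b <- o) tau b *: b ^t* = 1.
Proof.
move=> t [oA oE]; rewrite -[RHS]star1 [in RHS](oE 1) ?fd_one // star_sum.
apply: eq_big_seq => b bo.
by rewrite starZ mulr1 (ftr_star t) ?conjCK ?(oA b bo).
Qed.

End Twirl.

(** * Factors and their commutants *)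
Section Factor.
Variables (R : realType) (n : nat).
Local Notation C := R[i].
Local Notation Mx := 'M[C]_n.+1.
Implicit Types (a : C) (x y m : Mx) (A N M : fdVNA R n) (U : {vspace Mx}).
Implicit Types (tau : {scalar Mx}) (o : seq Mx).

Lemma twirl_in A M o m : (A <= M)%VS -> {in o, forall b, b \in A} -> m \in M ->
  twirl o m \in M.
Proof.
move=> /subvP AM oA mM; rewrite /twirl big_seq; apply: memv_suml => b bo.
by rewrite !fdM ?fd_star // AM ?oA.
Qed.

Lemma commutantP A x : reflect (forall y, y \in A -> x * y = y * x) (x \in 'C(A)%VS).
Proof. exact: centvP. Qed.

Lemma twirl_cent A tau o m : faithful_trace A tau -> frame tau A o ->
  twirl o m \in 'C(A)%VS.
Proof. by move=> t f; apply/commutantP => y yA; rewrite (twirl_comm _ t f). Qed.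

Lemma factor_scalar N x : is_factor N -> x \in N -> x \in 'C(N)%VS ->
  exists a, x = a *: 1.
Proof.
move=> fN xN xC.
have : x \in 'Z(N)%VS by rewrite memv_cap xN xC.
by rewrite fN => /vlineP.
Qed.

Lemma factor_scalar_trace N x : is_factor N -> x \in N -> x \in 'C(N)%VS ->
  x = (\tr x / n.+1%:R) *: 1.
Proof.
move=> fN xN xC; have [a ->] := factor_scalar fN xN xC.
by rewrite linearZ /= mxtrace1 mulfK // pnatr_eq0.
Qed.

(** If the sum vanished then all frame vectors would, and with them the unit. *)
Lemma frame_norm_gt0 A tau o : faithful_trace A tau -> frame tau A o ->
  0 < \sum_(b <- o) tau (b ^t* * b).
Proof.
move=> t [oA oE]; rewrite lt_neqAle big_seq sumr_ge0 ?andbT; last first.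
  by move=> b bo; rewrite (ftr_ge0 t) ?oA.
apply/eqP => s0; have := oner_eq0 Mx; rewrite [1]oE ?fd_one //.
rewrite big_seq big1 ?eqxx // => b bo.
have := s0 => /esym/eqP; rewrite psumr_eq0; last first.
  by move=> c co; rewrite (ftr_ge0 t) ?oA.
move=> /allP/(_ b bo); rewrite bo => /eqP /(ftr_eq0 t (oA _ bo)) ->.
by rewrite scaler0.
Qed.

Lemma scaled_oneM a x y : a *: (1 : Mx) * x * y = a *: (x * y).
Proof. by rewrite -!scalerAl mul1r. Qed.

(** After exchanging the sums, the inner one is [twirl o k] for [k] in [N]; it lies in
    [N] and commutes with [N], so for a factor it is a multiple of [\tr k], and what
    remains is the expansion of 1.  The formula writes [m] as a sum of products of
    elements of [N] with elements that commute with [N] and that lie in any algebra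
    containing [N] and [m]; it is a substitute for an isomorphism of [N] with a full
    matrix algebra. *)
Lemma factor_resolution N o : is_factor N ->
  frame (@mxtrace C n.+1) N o ->
  exists a, forall m, m = a *: \sum_(g <- o) g * twirl o (g ^t* * m).
Proof.
move=> fN f; have [oN oE] := f; have t := mxtrace_faithful N.
have f' := frame_star t f.
pose Z : Mx := \sum_(b <- o) b ^t* * b.
have ZE : Z = (\tr Z / n.+1%:R) *: 1.
  have ZE : Z = twirl [seq b ^t* | b <- o] 1.
    by rewrite twirl_star; apply: eq_bigr => b _; rewrite mulr1.
  apply: (factor_scalar_trace fN); rewrite ZE ?(twirl_cent _ t f') //.
  by apply: (twirl_in (subvv N)); [case: f' | exact: fd_one].
have trZ : 0 < \tr Z by rewrite linear_sum; apply: (frame_norm_gt0 t f).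
have n0 : n.+1%:R != 0 :> C by rewrite pnatr_eq0.
pose z := \tr Z / n.+1%:R.
have z0 : z != 0 by rewrite mulf_neq0 ?invr_eq0 // gt_eqF.
have tw k : k \in N -> twirl o k = (z * \tr k / n.+1%:R) *: 1.
  move=> kN; rewrite [LHS](factor_scalar_trace fN) ?(twirl_cent _ t f) //.
    congr (_ / _ *: _); transitivity (\tr (Z * k)).
      rewrite /twirl mulr_suml !linear_sum; apply: eq_bigr => b _ /=.
      by rewrite mxtraceM mulrA.
    by rewrite ZE -scalerAl mul1r linearZ.
  exact: (twirl_in (subvv N)).
exists (n.+1%:R / z) => m.
transitivity ((n.+1%:R / z) *: \sum_(k <- o) twirl o k * m * k ^t*).
  rewrite big_seq (eq_bigr (fun k => (z / n.+1%:R) *: (m * (\tr k *: k ^t*)))).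
    rewrite -scaler_sumr -big_seq -mulr_sumr (frame_unit t f) mulr1 scalerA.
    by rewrite mulrA divfK // divff // scale1r.
  move=> k ko; rewrite tw ?oN // scaled_oneM -scalerAr scalerA.
  by rewrite mulrAC.
congr (_ *: _).
rewrite /twirl (eq_bigr (fun k => \sum_(b <- o) b * k * b ^t* * m * k ^t*)).
  rewrite exchange_big; apply: eq_bigr => b _; rewrite mulr_sumr.
  by apply: eq_bigr => k _; rewrite !mulrA.
by move=> k _; rewrite !mulr_suml.
Qed.

Lemma scalar_of_comm x : (forall m, x * m = m * x) ->
  x = (\tr x / n.+1%:R) *: 1.
Proof.
move=> xC; suff [a ->] : exists a, x = a *: 1.
  by rewrite linearZ /= mxtrace1 mulfK // pnatr_eq0.
exists (x 0 0); apply/matrixP => i j.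
have := congr1 (fun y : Mx => y 0 j) (xC (delta_mx 0 i)).
rewrite -[x * _]/(x *m _) -[_ * x]/(_ *m x) !mxE.
rewrite (bigD1 0) //= big1 => [|k k0]; last by rewrite !mxE (negPf k0) mulr0.
rewrite [in RHS](bigD1 i) //= [in RHS]big1 => [|k ki]; last first.
  by rewrite !mxE eqxx (negPf ki) mul0r.
by rewrite !mxE !eqxx !addr0 mul1r eq_sym => <-.
Qed.

(** A factor and its commutant together generate all matrices, by
    [factor_resolution], so only scalars commute with both. *)
Lemma comm_factor_commutant N x : is_factor N ->
  x \in 'C(N)%VS -> (forall y, y \in 'C(N)%VS -> x * y = y * x) ->
  x = (\tr x / n.+1%:R) *: 1.
Proof.
move=> fN /commutantP xN xC; apply: scalar_of_comm => m.
have t := mxtrace_faithful N.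
have [o f] := frame_exists t (subvv N).
have [a mE] := factor_resolution fN f.
rewrite (mE m) -scalerAr -scalerAl mulr_suml mulr_sumr; congr (_ *: _).
apply: eq_big_seq => g /(proj1 f) gN.
by rewrite mulrA xN // -!mulrA xC // (twirl_cent _ t f).
Qed.

(** By [factor_resolution], [M] is generated by [N] and the relative commutant of
    [N] in [M]. *)
Lemma comm_generated N M x : is_factor N -> (N <= M)%VS ->
  x \in 'C(N)%VS -> (forall y, y \in M -> y \in 'C(N)%VS -> x * y = y * x) ->
  x \in 'C(M)%VS.
Proof.
move=> fN NM /commutantP xN xC; apply/commutantP => m mM.
have t := mxtrace_faithful N.
have [o f] := frame_exists t (subvv N).
have [a mE] := factor_resolution fN f.
rewrite (mE m) -scalerAr -scalerAl mulr_suml mulr_sumr; congr (_ *: _).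
apply: eq_big_seq => g /[dup] go /(proj1 f) gN.
rewrite mulrA xN // -!mulrA xC // ?(twirl_cent _ t f) //.
apply: (twirl_in NM); first by case: f.
by rewrite fdM // fd_star // (subvP NM).
Qed.
End Factor.

(** * The relative commutant *)
Section RelativeCommutant.
Variables (R : realType) (n : nat).
Local Notation C := R[i].
Local Notation Mx := 'M[C]_n.+1.
Implicit Types (N M : fdVNA R n) (x : Mx).

Definition commutant_fdVNA N : fdVNA R n :=
  @FdVNA R n [aspace of 'C(N)%VS] (commutant_one N)
    (fun x xC => commutant_star xC).

Fact relcomm_is_aspace N M : is_aspace (M :&: 'C(N))%VS.
Proof.
rewrite /is_aspace has_algid1 ?memv_cap ?fd_one ?commutant_one //=.
apply/prodvP => u w /memv_capP[uM uC] /memv_capP[wM wC].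
by rewrite memv_cap fdM //= (fdM (A := commutant_fdVNA N)).
Qed.

Fact relcomm_one N M : 1 \in ASpace (relcomm_is_aspace N M).
Proof. by rewrite memv_cap fd_one commutant_one. Qed.

Fact relcomm_star N M x : x \in ASpace (relcomm_is_aspace N M) ->
  x ^t* \in ASpace (relcomm_is_aspace N M).
Proof.
by move=> /memv_capP[xM xC]; rewrite memv_cap fd_star //= commutant_star.
Qed.

Definition relcomm N M : fdVNA R n :=
  FdVNA (relcomm_one N M) (@relcomm_star N M).

Lemma relcommP N M x :
  reflect (x \in M /\ x \in 'C(N)%VS) (x \in relcomm N M).
Proof. exact: memv_capP. Qed.
End RelativeCommutant.

(** * Adjoints in a von Neumann algebra and matrices over it *)
Section VnStar.
Variables (R : realType) (L : vonNeumannAlgebra R).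
Implicit Types (x y : L) (xi eta : vn_space L).

(** Adjoints are unique, and the representation is faithful: this is where all
    algebraic laws of [vn_star] come from. *)
Lemma vn_star_unique x y :
  (forall xi eta, hs_dot _ (vn_rep x xi) eta = hs_dot _ xi (vn_rep y eta)) ->
  vn_star x = y.
Proof.
move=> adj; apply: (@vn_rep_inj _ L); apply/funext => xi.
apply/eqP; rewrite -subr_eq0 -(dnorm_eq0 (hs_dot _)); apply/eqP.
by rewrite linearBr /= -vn_rep_star -adj subrr.
Qed.

Lemma vn_repD x y xi : vn_rep (x + y) xi = vn_rep x xi + vn_rep y xi.
Proof. by have := vn_rep_linear 1 x y xi; rewrite !scale1r. Qed.

Lemma vn_rep0 xi : vn_rep (0 : L) xi = 0.
Proof. by apply: (addrI (vn_rep (0 : L) xi)); rewrite -vn_repD !addr0. Qed.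

Lemma vn_repZ a x xi : vn_rep (a *: x) xi = a *: vn_rep x xi.
Proof. by have := vn_rep_linear a x 0 xi; rewrite vn_rep0 !addr0. Qed.

Lemma vn_starD x y : vn_star (x + y) = vn_star x + vn_star y.
Proof.
apply: vn_star_unique => xi eta.
by rewrite !vn_repD linearDl linearDr /= -!vn_rep_star.
Qed.

Lemma vn_starZ a x : vn_star (a *: x) = a^* *: vn_star x.
Proof.
apply: vn_star_unique => xi eta; rewrite !vn_repZ linearZl_LR linearZr_LR /=.
by rewrite conjCK vn_rep_star.
Qed.

Lemma vn_starM x y : vn_star (x * y) = vn_star y * vn_star x.
Proof.
by apply: vn_star_unique => xi eta; rewrite !vn_rep_mul -!vn_rep_star.
Qed.

Lemma vn_star1 : vn_star (1 : L) = 1.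
Proof. by apply: vn_star_unique => xi eta; rewrite !vn_rep_one. Qed.

Lemma vn_star0 : vn_star (0 : L) = 0.
Proof. by have := vn_starZ 0 (0 : L); rewrite conjC0 !scale0r. Qed.
End VnStar.

Section Tensor.
Variables (R : realType) (n : nat) (L : tracialVNA R).
Local Notation C := R[i].
Local Notation Mx := 'M[C]_n.+1.
Implicit Types (x y : Mx) (l k : L) (P Q : 'M[L]_n.+1).

Lemma tensM x y l k : tens x l * tens y k = tens (x * y) (l * k).
Proof.
apply/matrixP => i j; rewrite -[tens x l * _]/(_ *m _) -[x * y]/(x *m y) !mxE.
rewrite scaler_suml; apply: eq_bigr => a _.
by rewrite !mxE -scalerAl -scalerAr scalerA.
Qed.

Lemma tensDl x y l : tens (x + y) l = tens x l + tens y l.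
Proof. by apply/matrixP => i j; rewrite !mxE scalerDl. Qed.

Lemma tens0l l : tens (0 : Mx) l = 0.
Proof. by apply/matrixP => i j; rewrite !mxE scale0r. Qed.

Lemma tensNl x l : tens (- x) l = - tens x l.
Proof. by apply/matrixP => i j; rewrite !mxE scaleNr. Qed.

Lemma tensBl x y l : tens (x - y) l = tens x l - tens y l.
Proof. by rewrite tensDl tensNl. Qed.

Lemma tens_suml I (r : seq I) (p : pred I) (F : I -> Mx) l :
  tens (\sum_(i <- r | p i) F i) l = \sum_(i <- r | p i) tens (F i) l.
Proof. exact: (big_morph (fun x => tens x l) (fun x y => tensDl x y l) (tens0l l)). Qed.

Lemma tens_scale a x l : tens (a *: x) l = tens x (a *: l).
Proof. by apply/matrixP => i j; rewrite !mxE scalerA mulrC. Qed.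

Lemma tens11 : tens (1 : Mx) (1 : L) = 1.
Proof.
by apply/matrixP => i j; rewrite !mxE; case: eqP; rewrite ?scale1r ?scale0r.
Qed.

Lemma adjL_D P Q : adjL (P + Q) = adjL P + adjL Q.
Proof. by apply/matrixP => i j; rewrite !mxE vn_starD. Qed.

Lemma adjL0 : adjL (0 : 'M[L]_n.+1) = 0.
Proof. by apply/matrixP => i j; rewrite !mxE vn_star0. Qed.

Lemma adjL_sum I (r : seq I) (p : pred I) (F : I -> 'M[L]_n.+1) :
  adjL (\sum_(i <- r | p i) F i) = \sum_(i <- r | p i) adjL (F i).
Proof. exact: (big_morph _ adjL_D adjL0). Qed.

Lemma adjL_M P Q : adjL (P * Q) = adjL Q * adjL P.
Proof.
apply/matrixP => i j; rewrite -[P * Q]/(P *m Q) -[_ * adjL P]/(_ *m _) !mxE.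
rewrite (big_morph _ (@vn_starD _ L) (vn_star0 L)); apply: eq_bigr => a _.
by rewrite !mxE vn_starM.
Qed.

Lemma adjL_tens x l : adjL (tens x l) = tens (x ^t*) (vn_star l).
Proof. by apply/matrixP => i j; rewrite !mxE vn_starZ. Qed.

Lemma tva_mxtrace_tens x : tva_tr L (\tr (tens x 1)) = \tr x.
Proof.
rewrite [\tr (tens x 1)]/mxtrace linear_sum; apply: eq_bigr => i _.
by rewrite !mxE scalarZ tva_tr_unit mulr1.
Qed.

(** The complement of a projection is positive, so its trace is nonnegative. *)
Lemma tva_mxtrace_proj P : P * P = P -> adjL P = P ->
  tva_tr L (\tr P) <= n.+1%:R.
Proof.
move=> PP Pstar; rewrite -subr_ge0.
have -> : n.+1%:R - tva_tr L (\tr P) = tva_tr L (\tr (adjL (1 - P) * (1 - P))).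
  have -> : adjL (1 - P) * (1 - P) = 1 - P.
    have -> : adjL (1 - P) = 1 - P.
      have : adjL (1 - P) + adjL P = 1.
        by rewrite -adjL_D subrK -tens11 adjL_tens star1 vn_star1.
      by rewrite Pstar => /(canRL (addrK _)).
    by rewrite mulrBl mul1r mulrBr mulr1 PP subrr subr0.
  rewrite [\tr (1 - P)]linearB /= linearB /=; congr (_ - _).
  by rewrite -tens11 tva_mxtrace_tens mxtrace1.
rewrite [\tr _]/mxtrace linear_sum; apply: sumr_ge0 => i _.
rewrite -[_ * (1 - P)]/(_ *m _) mxE linear_sum; apply: sumr_ge0 => j _ /=.
by rewrite !mxE tva_tr_pos.
Qed.

Lemma in_tensor_comm (M : {vspace Mx}) P x : in_tensor M P -> x \in 'C(M)%VS ->
  tens x 1 * P = P * tens x 1.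
Proof.
move=> [k [m [l [mM ->]]]] /centvP xC; rewrite mulr_sumr mulr_suml.
by apply: eq_bigr => i _; rewrite !tensM mulr1 mul1r xC.
Qed.
End Tensor.

(** * A lower bound on the number of colours *)
Section LowerBound.
Variables (R : realType) (n : nat) (N M : fdVNA R n) (sNM : (N <= M)%VS).
Hypothesis fN : is_factor N.
Local Notation C := R[i].
Local Notation Mx := 'M[C]_n.+1.
Local Notation tr := (@mxtrace C n.+1).
Local Notation Q := (relcomm N M).
Variables (h : seq Mx) (fh : frame tr Q h).

Let Z := twirl h 1.

Lemma twirl_relcomm x o : frame tr Q o -> x \in 'C(N)%VS ->
  twirl o x \in 'C(M)%VS.
Proof.
move=> fo xC; have tQ := mxtrace_faithful Q.
apply: (comm_generated fN sNM).
  apply: (twirl_in (M := commutant_fdVNA N) (A := Q)) => //.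
    exact: capvSr.
  by case: fo.
by move=> y yM yN; rewrite (twirl_comm _ tQ fo) //; apply/relcommP.
Qed.

(** Up to the central factor [Z], twirling over the relative commutant is the
    trace-preserving conditional expectation of the commutant of [N] onto the
    commutant of [M]. *)
Lemma colouring_orthogonal x : x \in 'C(N)%VS ->
  hs_orthogonal 'C(M)%VS (Z * x - twirl [seq b ^t* | b <- h] x).
Proof.
move=> xC y yC; rewrite -[_ *m _]/(y ^t* * _) mulrBr linearB /=.
have ysC : y ^t* \in 'C(M)%VS by rewrite commutant_star.
apply/eqP; rewrite subr_eq0; apply/eqP.
rewrite /Z /twirl big_map mulr_suml !mulr_sumr !linear_sum.
apply: eq_big_seq => b /(proj1 fh)/relcommP[bM _] /=.
rewrite trmxCK mulr1 !mulrA [RHS]mxtraceM !mulrA.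
by rewrite (centvP ysC).
Qed.

Variables (L : tracialVNA R) (c : nat).

(** Slicing each [P a] by the regular trace of the relative commutant produces a
    projection [p a].  Its trace is at most that of the unit, whereas the [p a] add
    up to the slice of the unit, whose trace is larger by the factor
    [\sum_(b <- h) tr (b ^t* * b)]. *)
Theorem colouring_lower_bound : colourable (commutant_graph sNM) L c ->
  \sum_(b <- h) tr (b ^t* * b) <= c%:R.
Proof.
move=> [P [PM Pproj Psum Pcol]].
have tQ := mxtrace_faithful Q; have f's := frame_star tQ fh.
pose N' := commutant_fdVNA N; have tN' := mxtrace_faithful N'.
have [k fk] := frame_exists tN' (subvv N').
have fks := frame_star tN' fk.
have kN' b : b \in k -> b \in 'C(N)%VS by move=> /(proj1 fk).
have QN' : (Q <= 'C(N))%VS := capvSr _ _.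
have hN' b : b \in h -> b \in 'C(N)%VS by move=> /(proj1 fh)/relcommP[].
pose K := \sum_(b <- k) tr (b ^t* * b).
have K0 : 0 < K := frame_norm_gt0 tN' fk.
(* The commutant of a factor is a factor: twirling over its frame [k] collapses
   everything in the commutant to a scalar. *)
have sumk : \sum_(b <- k) b * b ^t* = (K / n.+1%:R) *: 1.
  have -> : \sum_(b <- k) b * b ^t* = twirl k 1.
    by apply: eq_bigr => b _; rewrite mulr1.
  rewrite [LHS](comm_factor_commutant fN); first congr (_ / _ *: _).
  - rewrite /twirl linear_sum; apply: eq_bigr => b _ /=.
    by rewrite mulr1 mxtraceM.
  - apply: (twirl_in (A := N') (M := N')) (subvv _) _ (fd_one N').
    exact: (proj1 fk).
  - by move=> y yN; rewrite (twirl_comm _ tN' fk).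
have twk x : x \in 'C(N)%VS ->
    twirl [seq b ^t* | b <- k] x = (K / n.+1%:R ^+ 2 * \tr x) *: 1.
  move=> xN; rewrite [LHS](comm_factor_commutant fN).
  - congr (_ *: _); rewrite twirl_star linear_sum /=.
    transitivity (\tr (x * \sum_(b <- k) b * b ^t*) / n.+1%:R).
      congr (_ / _); rewrite mulr_sumr linear_sum; apply: eq_bigr => b _ /=.
      by rewrite -mulrA mxtraceM mulrA.
    rewrite sumk -scalerAr mulr1 linearZ /= expr2 invfM; ring.
  - apply: (twirl_in (A := N') (M := N')) (subvv _) _ xN.
    exact: (proj1 fks).
  - by move=> y yN; rewrite (twirl_comm _ tN' fks).
have ZM : Z \in 'C(M)%VS by apply: (twirl_relcomm fh); apply: commutant_one.
have ZN : Z \in 'C(N)%VS.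
  apply: (twirl_in (A := Q) (M := N')) QN' _ (fd_one N'); exact: (proj1 fh).
have n0 : n.+1%:R != 0 :> C by rewrite pnatr_eq0.
(* The scale that makes the partial trace below fix [P a]. *)
pose s := n.+1%:R ^+ 2 / K.
have s_real : s^* = s.
  by apply/CrealP/ger0_real; rewrite divr_ge0 ?exprn_ge0 ?ler0n // ltW.
have Z_star : Z ^t* = Z.
  rewrite /Z /twirl star_sum; apply: eq_bigr => b _.
  by rewrite !mulr1 starM_mx trmxCK.
(* [p a] is the slice of [P a] by the regular trace of the relative commutant,
   amplified to matrices over [L] that commute with the commutant of [N]. *)
pose p a := \sum_(b <- k) tens (s *: b ^t*) 1 * P a * tens (Z * b) 1.
have PP a : P a * P a = P a by case: (Pproj a).
have PC a x : x \in 'C(M)%VS -> P a * tens x 1 = tens x 1 * P a.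
  by move=> xM; rewrite (in_tensor_comm (PM a)).
(* The colouring condition turns [P a * (Z b) * P a] into a twirl times [P a], and
   the sum over [b] collapses that twirl to the expansion of 1 in the frame [h]. *)
have pP a : p a * P a = P a.
  pose F b := twirl [seq d ^t* | d <- h] b.
  transitivity (tens (\sum_(b <- k) (s *: b ^t*) * F b) 1 * P a).
    rewrite /p mulr_suml tens_suml mulr_suml; apply: eq_big_seq => b /kN' bN.
    have FN : F b \in 'C(N)%VS.
      apply: (twirl_in (A := Q) (M := N')) QN' _ bN; exact: (proj1 f's).
    have FM : F b \in 'C(M)%VS by apply: twirl_relcomm.
    have xN : Z * b - F b \in 'C(N)%VS by rewrite memvB // (fdM (A := N')).
    have := Pcol a _ xN (colouring_orthogonal bN).
    rewrite -[_ *m _ *m _]/(P a * _ * P a) tensBl mulrBr mulrBl.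
    move=> /eqP; rewrite subr_eq0 (PC a (F b)) // -[X in _ == X]mulrA PP; move=> /eqP PbP.
    by rewrite -mulrA -mulrA [P a * _]mulrA PbP mulrA tensM mulr1.
  rewrite -[RHS]mul1r -tens11; congr (tens _ 1 * _).
  transitivity (s *: \sum_(d <- h) twirl [seq b ^t* | b <- k] (d ^t*) * d).
    rewrite (eq_bigr (fun b => \sum_(d <- h) s *: (b ^t* * d ^t* * b * d))).
      rewrite exchange_big scaler_sumr; apply: eq_bigr => d _.
      rewrite twirl_star mulr_suml scaler_sumr; apply: eq_bigr => b _.
      by [].
    move=> b _; rewrite /F twirl_star -scalerAl mulr_sumr scaler_sumr.
    by apply: eq_bigr => d _; rewrite !mulrA.
  rewrite [in RHS](proj2 fh 1 (fd_one _)) scaler_sumr.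
  apply: eq_big_seq => d /hN' dN; rewrite twk ?commutant_star // -scalerAl mul1r.
  rewrite scalerA mulr1 mulrA /s.
  by rewrite mulrA divfK ?gt_eqF // divff ?mul1r // expf_neq0.
have p_comm a x : x \in 'C(N)%VS -> p a * tens x 1 = tens x 1 * p a.
  move=> xN; have [j [m [l [_ PE]]]] := PM a.
  have pE : p a = \sum_i tens (s *: twirl [seq b ^t* | b <- k] (m i * Z)) (l i).
    rewrite /p PE (eq_bigr (fun b => \sum_i tens
      (s *: (b ^t* * (m i * Z) * b)) (l i))).
      rewrite exchange_big; apply: eq_bigr => i _ /=.
      by rewrite twirl_star scaler_sumr tens_suml.
    move=> b _; rewrite mulr_sumr mulr_suml; apply: eq_bigr => i _.
    by rewrite !tensM mul1r mulr1 -!scalerAl !mulrA.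
  rewrite pE mulr_suml mulr_sumr; apply: eq_bigr => i _.
  rewrite !tensM mul1r mulr1 -scalerAl -scalerAr.
  by rewrite (twirl_comm _ tN' fks xN).
(* Slicing the identity [pP] once more: [p a] commutes with everything that the
   slice map multiplies by. *)
have pp a : p a * p a = p a.
  rewrite {2}/p mulr_sumr; apply: eq_big_seq => b /kN' bN.
  rewrite !mulrA p_comm ?memvZ ?commutant_star // -2![in LHS]mulrA.
  by rewrite [p a * _]mulrA pP mulrA.
have p_adj a : adjL (p a) = p a.
  rewrite /p adjL_sum; apply: eq_bigr => b _.
  have [_ Padj] := Pproj a.
  rewrite !adjL_M !adjL_tens vn_star1 Padj starM_mx Z_star starZ trmxCK s_real.
  have sE (y : Mx) : tens (s *: y) (1 : L) = tens (s *: 1) 1 * tens y 1.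
    by rewrite tensM mulr1 -scalerAl mul1r.
  have sE' (y : Mx) : tens (s *: y) (1 : L) = tens y 1 * tens (s *: 1) 1.
    by rewrite tensM mulr1 -scalerAr mulr1.
  have sC : s *: 1 \in 'C(M)%VS by rewrite memvZ // commutant_one.
  have tM (y z : Mx) : tens (y * z) (1 : L) = tens y 1 * tens z 1.
    by rewrite tensM mulr1.
  rewrite (sE b) (sE' (b ^t*)) (tM _ Z) (tM Z) -!mulrA; congr (_ * _).
  rewrite [P a * _]mulrA [in RHS](mulrA (P a)) !PC // !mulrA; congr (_ * _ * _).
  by rewrite -!tM mulr_algl mulr_algr.
have sump : \sum_a p a = tens (\sum_(b <- k) (s *: b ^t*) * Z * b) 1.
  rewrite tens_suml exchange_big; apply: eq_bigr => b _ /=.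
  rewrite -mulr_suml -mulr_sumr Psum -[1%:M]/(1 : 'M[L]_n.+1) mulr1 tensM.
  by rewrite mulr1 mulrA.
have trp : \tr (\sum_(b <- k) (s *: b ^t*) * Z * b) = n.+1%:R * \tr Z.
  transitivity (\tr (s *: (Z * \sum_(b <- k) b * b ^t*))).
    rewrite mulr_sumr scaler_sumr !linear_sum; apply: eq_bigr => b _ /=.
    by rewrite -!scalerAl !linearZ /= -mulrA mxtraceM mulrA.
  rewrite sumk -scalerAr mulr1 !linearZ /= mulrA /s expr2.
  by field; rewrite nat1r n0 gt_eqF.
have : tva_tr L (\tr (\sum_a p a)) <= \sum_(a < c) n.+1%:R.
  rewrite [\tr _](raddf_sum (@mxtrace L n.+1)) linear_sum; apply: ler_sum => a _.
  exact: tva_mxtrace_proj.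
rewrite sump tva_mxtrace_tens trp sumr_const card_ord -[X in _ <= X](mulr_natr n.+1%:R c).
rewrite ler_pM2l ?ltr0n // /Z /twirl linear_sum /=; congr (_ <= _).
by apply: eq_bigr => b _; rewrite mulr1 mxtraceM.
Qed.
End LowerBound.

(** * Minimal projections *)
Section MinimalProjections.
Variables (R : realType) (n : nat) (Q : fdVNA R n).
Local Notation C := R[i].
Local Notation Mx := 'M[C]_n.+1.
Local Notation tr := (@mxtrace C n.+1).
Implicit Types (p e f x y z : Mx).

(** Take for [e] the orthogonal projection of 1 onto [J].  For [j] in [J] let
    [w := j ^t* * (1 - e)].  As [J] is a right ideal, [j * w] lies in [J], and its
    product with [1 - e] in the Hilbert--Schmidt form is [tr (w ^t* * w)]; so [w]
    vanishes, and taking [j := e] shows that [e] is a projection. *)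
Lemma right_ideal_projection (J : {vspace Mx}) : (J <= Q)%VS ->
  (forall j q, j \in J -> q \in Q -> j * q \in J) ->
  exists e, [/\ e \in J, e ^t* = e & forall j, j \in J -> e * j = j].
Proof.
move=> JQ Jideal; have tQ := mxtrace_faithful Q.
have [o [oJ oE]] := frame_exists tQ JQ.
pose e : Mx := \sum_(b <- o) tr (b ^t*) *: b.
have eJ : e \in J.
  by rewrite /e big_seq; apply: memv_suml => b bo; rewrite memvZ ?oJ.
have ortho j : j \in J -> tr (j ^t* * (1 - e)) = 0.
  move=> jJ; rewrite mulrBr mulr1 linearB /= mxtrace_star; apply/eqP.
  rewrite subr_eq0; apply/eqP; rewrite {1}(oE j) // /e mulr_sumr.
  rewrite !(linear_sum (@mxtrace C n.+1)) rmorph_sum; apply: eq_bigr => b _ /=.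
  rewrite -scalerAr !mxtraceZ rmorphM /= -!mxtrace_star starM_mx trmxCK.
  by rewrite mulrC.
have fix_star j : j \in J -> j ^t* * (1 - e) = 0.
  move=> jJ; apply: mxtrace_starM_eq0.
  have wQ : j ^t* * (1 - e) \in Q.
    by rewrite fdM ?fd_star ?memvB ?fd_one ?(subvP JQ).
  by have := ortho _ (Jideal _ _ jJ wQ); rewrite starM_mx -mulrA.
have e_star : e ^t* = e.
  have /eqP := fix_star _ eJ; rewrite mulrBr mulr1 subr_eq0 => /eqP eE.
  by rewrite -[RHS]trmxCK eE starM_mx trmxCK.
exists e; split=> // j jJ; have /eqP := fix_star _ jJ.
rewrite mulrBr mulr1 subr_eq0 => /eqP /(congr1 (fun z : Mx => z ^t*)).
by rewrite starM_mx trmxCK e_star.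
Qed.

Record projection p : Prop := Projection {
  proj_in : p \in Q; proj_idem : p * p = p; proj_star : p ^t* = p }.

Definition minimal p : Prop :=
  p != 0 /\ forall y, y \in Q -> exists a, p * y * p = a *: p.

(** The eigenvector is found inside the row space of [f], where [x] acts. *)
Lemma corner_eigenvector f x : f != 0 -> f * f = f -> x * f = x ->
  exists a, exists2 v : 'rV[C]_n.+1, v != 0 & v *m f = v /\ v *m x = a *: v.
Proof.
move=> f0 ff xf.
have r0 : (0 < \rank f)%N by rewrite lt0n mxrank_eq0.
pose B := row_base f.
have [a /eigenvalueP[w wA w0]] := eigenvalue_closed (B *m x *m pinvmx B) r0.
have Bf : (B :=: f)%MS by apply: eq_row_base.
exists a, (w *m B).
  by rewrite mulmx_free_eq0 ?row_base_free.
have subB (u : 'rV[C]_n.+1) : (u <= f)%MS -> u *m f = u.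
  by move=> /submxP[D ->]; rewrite -mulmxA -[f *m f]/(f * f) ff.
split; first by apply: subB; rewrite mulmx_sub // Bf.
have BxB : (B *m x <= B)%MS.
  by rewrite Bf -xf -[x * f]/(x *m f) mulmxA submxMl.
by rewrite -mulmxA -(mulmxKpV BxB) mulmxA wA scalemxAl.
Qed.

Lemma sub_projection_rank e f : e * e = e -> e * f = e -> f * e = e ->
  e != f -> (\rank e < \rank f)%N.
Proof.
move=> ee ef fe nef.
have sef : (e <= f)%MS by rewrite -ef -[e * f]/(e *m f) submxMl.
rewrite (ltn_leqif (mxrank_leqif_sup sef)); apply: contra nef.
move=> /submxP[D fD]; apply/eqP; rewrite -fe {1}fD -[(D *m e) * e]/(D *m e *m e).
by rewrite -mulmxA -[e *m e]/(e * e) ee -fD.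
Qed.

(** If the corner of [f] contains a non-scalar [x], subtract an eigenvalue from [x].  The
    right ideal generated by the result contains a nonzero projection, which kills
    the eigenvector and hence has smaller rank than [f]. *)
Lemma exists_minimal f : projection f -> f != 0 ->
  exists p, [/\ projection p, minimal p & f * p = p].
Proof.
have [k] := ubnP (\rank f); elim: k f => // k IH f rkf pf f0.
have [fQ ff fs] := pf.
have [[y [yQ yN]]|fmin] := pselect (exists y, y \in Q /\
    forall a, f * y * f != a *: f); last first.
  exists f; split=> //; split=> // y yQ; apply: contra_notP fmin => ya.
  by exists y; split=> // a; apply/eqP => ye; apply: ya; exists a.
pose x := f * y * f.
have xf : x * f = x by rewrite /x -mulrA ff.
have [a [v v0 [vf vx]]] := corner_eigenvector f0 ff xf.
(* A nonzero element of the corner that kills [v], so that it generates a right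
   ideal smaller than that of [f]. *)
pose z := x - a *: f.
have zQ : z \in Q by rewrite /z memvB ?memvZ // !fdM.
have z0 : z != 0 by rewrite subr_eq0.
have fz : f * z = z by rewrite /z mulrBr -scalerAr ff /x !mulrA ff.
have vz : v *m z = 0 by rewrite mulmxBr vx -scalemxAr vf subrr.
have [||e [eJ es efix]] := @right_ideal_projection (amull z @: Q)%VS.
- by apply/subvP => _ /memv_imgP[q qQ ->]; rewrite lfunE /= fdM.
- move=> _ q /memv_imgP[w wQ ->] qQ; rewrite lfunE /= -mulrA.
  apply/memv_imgP; exists (w * q); first by rewrite fdM.
  by rewrite lfunE.
have [q qQ eE] := memv_imgP eJ; rewrite lfunE /= in eE.
have eQ : e \in Q by rewrite eE fdM.
have ee : e * e = e by apply: efix.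
have zJ : z \in (amull z @: Q)%VS.
  by apply/memv_imgP; exists 1; rewrite ?fd_one // lfunE /= mulr1.
have e0 : e != 0.
  by apply: contraNneq z0 => e0; rewrite -(efix z zJ) e0 mul0r.
have fe : f * e = e by rewrite eE mulrA fz.
have ef : e * f = e by rewrite -es -{1}fs -starM_mx fe.
have [||p [pp pm ep]] := IH e _ _ e0.
- rewrite -ltnS; apply: leq_ltn_trans rkf.
  apply: sub_projection_rank => //; apply: contraNneq v0 => efE.
  by rewrite -vf -efE eE -[z * q]/(z *m q) mulmxA vz mul0mx.
- by split.
by exists p; split=> //; rewrite -ep mulrA fe.
Qed.

Lemma minimal_decomposition f : projection f ->
  exists s : seq Mx, [/\ {in s, forall p, projection p},
    {in s, forall p, minimal p}, {in s, forall p, f * p = p},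
    pairwise (fun p q : Mx => p * q == 0) s & \sum_(p <- s) p = f].
Proof.
have [k] := ubnP (\rank f); elim: k f => // k IH f rkf pf.
have [-> | f0] := eqVneq f 0; first by exists [::]; split; rewrite ?big_nil.
have [p [pp pm fp]] := exists_minimal pf f0.
have [fQ ff fs] := pf; have [pQ pi ps] := pp.
have pf' : p * f = p by rewrite -ps -{1}fs -starM_mx fp.
pose g := f - p.
have gg : g * g = g.
  by rewrite /g mulrBl !mulrBr ff pf' fp pi subrr subr0.
have fg : f * g = g by rewrite /g mulrBr ff fp.
have gf : g * f = g by rewrite /g mulrBl ff pf'.
have pg : p * g = 0 by rewrite /g mulrBr pf' pi subrr.
have [||s [sp sm sg so ss]] := IH g.
- rewrite -ltnS; apply: leq_ltn_trans rkf; apply: sub_projection_rank => //.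
  apply: contraNneq (proj1 pm) => gE.
  by rewrite -pf' -gE pg.
- by split; rewrite ?memvB // /g starB fs ps.
exists (p :: s); split.
- by move=> q; rewrite inE => /predU1P[->|/sp].
- by move=> q; rewrite inE => /predU1P[->|/sm].
- move=> q; rewrite inE => /predU1P[->|qs] //.
  by rewrite -(sg _ qs) mulrA fg.
- rewrite /= so andbT; apply/allP => q qs.
  by rewrite -(sg _ qs) mulrA pg mul0r.
- by rewrite big_cons ss /g addrC subrK.
Qed.
End MinimalProjections.

(** * Matrix units of a matrix algebra *)
Section MatrixUnits.
Variables (R : realType) (n : nat) (Q : fdVNA R n).
Local Notation C := R[i].
Local Notation Mx := 'M[C]_n.+1.
Local Notation tr := (@mxtrace C n.+1).
Implicit Types (p e f x y z : Mx).

(** The algebra is presented as the algebra of the equivalence relation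
    [blk k = blk l] on ['I_r]: each class of indices is one full matrix block, with
    [e k l] as its units.  For indices in different blocks [e k l] may lie outside
    the algebra. *)
Record matrix_units r (blk : 'I_r -> 'I_r) (e : 'I_r -> 'I_r -> Mx) : Prop :=
  MatrixUnits {
    mu_in : forall k l, blk k = blk l -> e k l \in Q;
    mu_mul : forall k l m, blk k = blk l -> blk l = blk m ->
      e k l * e l m = e k m;
    mu_mul0 : forall k l l' m, l != l' -> e k l * e l' m = 0;
    mu_star : forall k l, (e k l) ^t* = e l k;
    mu_sum : \sum_k e k k = 1;
    mu_neq0 : forall k, e k k != 0;
    mu_span : forall x, x \in Q -> exists a : 'I_r -> 'I_r -> C,
      x = \sum_(kl | blk kl.1 == blk kl.2) a kl.1 kl.2 *: e kl.1 kl.2 }.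

Lemma projection_trace_gt0 p : projection Q p -> p != 0 -> 0 < tr p.
Proof.
move=> [_ pp ps] p0; rewrite -pp -{1}ps lt_neqAle mxtrace_starM_ge0 andbT.
by rewrite eq_sym; apply: contraNneq p0 => /mxtrace_starM_eq0 ->.
Qed.

(** Minimality makes both [a ^t* * a] and [a * a ^t*] scalar for [a := p * y * q], so
    [a] is a multiple of a partial isometry. *)
Lemma partial_isometry p q y : projection Q p -> projection Q q ->
  minimal Q p -> minimal Q q -> y \in Q -> p * y * q != 0 ->
  exists v, [/\ v \in Q, v * v ^t* = p, v ^t* * v = q & p * v = v].
Proof.
move=> pp pq [p0 pm] [q0 qm] yQ; move aE : (p * y * q) => a a0.
have [[pQ pi ps] [qQ qi qs]] := (pp, pq).
have aQ : a \in Q by rewrite -aE !fdM.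
have pa : p * a = a by rewrite -aE !mulrA pi.
have aq : a * q = a by rewrite -aE -mulrA qi.
have as_ : a ^t* = q * y ^t* * p by rewrite -aE !starM_mx ps qs mulrA.
have [c cE] : exists c, a ^t* * a = c *: q.
  have [|c cE] := qm (y ^t* * a); first by rewrite fdM ?fd_star.
  by exists c; rewrite -cE as_ -!mulrA pa aq.
have [d dE] : exists d, a * a ^t* = d *: p.
  have [|d dE] := pm (a * y ^t*); first by rewrite fdM ?fd_star.
  by exists d; rewrite -dE as_ !mulrA aq pa.
(* Both scalars compute [a * a ^t* * a]. *)
have cd : c = d.
  have : a * a ^t* * a = c *: a by rewrite -mulrA cE -scalerAr aq.
  rewrite dE -scalerAl pa => /eqP; rewrite -subr_eq0 -scalerBl scaler_eq0.
  by rewrite (negPf a0) orbF subr_eq0 => /eqP.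
have c0 : 0 < c.
  have := mxtrace_starM_ge0 a; rewrite cE mxtraceZ.
  rewrite pmulr_lge0 ?(projection_trace_gt0 pq) // le_eqVlt => /predU1P[|//].
  move=> c0; case/eqP: a0; apply: mxtrace_starM_eq0.
  by rewrite cE -c0 scale0r linear0.
pose s := (sqrtC c)^-1.
have s0 : sqrtC c != 0 by rewrite sqrtC_eq0 gt_eqF.
have ss : s * s * c = 1.
  by rewrite -[X in _ * X = _]sqrtCK expr2 -mulrA /s mulKf // mulVf.
have sR : s^* = s.
  by apply/CrealP/ger0_real; rewrite invr_ge0 sqrtC_ge0 ltW.
exists (s *: a); split.
- by rewrite memvZ.
- by rewrite starZ sR -scalerAl -scalerAr dE !scalerA -cd ss scale1r.
- by rewrite starZ sR -scalerAl -scalerAr cE !scalerA ss scale1r.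
- by rewrite -scalerAr pa.
Qed.

(** Decompose 1 into minimal projections.  Two of them are linked when some element of
    the algebra connects them; a partial isometry [v k] then joins each of them to
    the representative of its class, and [e k l := v k * (v l) ^t*]. *)
Lemma matrix_units_exist :
  exists r (blk : 'I_r -> 'I_r) (e : 'I_r -> 'I_r -> Mx), matrix_units blk e.
Proof.
have p1 : projection Q 1 by split; rewrite ?fd_one ?mulr1 ?star1.
have [s [sp sm _ so ss]] := minimal_decomposition p1.
pose p (k : 'I_(size s)) := s`_k.
have pP k : projection Q (p k) by apply/sp/mem_nth.
have pM k : minimal Q (p k) by apply/sm/mem_nth.
have po k l : k != l -> p k * p l = 0.
  have lt (k' l' : 'I_(size s)) : (k' < l')%N -> p k' * p l' = 0.
    move=> kl; have /(pairwiseP 0)/(_ k' l' _ _ kl) := so.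
    by rewrite !inE !ltn_ord => /(_ isT isT)/eqP.
  move=> kl; have [|lk|/val_inj kl'] := ltngtP k l; first exact: lt.
    have := congr1 (fun z : Mx => z ^t*) (lt _ _ lk).
    by rewrite starM_mx star0 !(proj_star (pP _)).
  by rewrite kl' eqxx in kl.
have p_sum : \sum_k p k = 1 by rewrite -ss (big_nth 0) big_mkord.
(* Linked projections are equivalent; the smallest index linked to [k]
   represents its class. *)
pose link k l := `[< exists2 y, y \in Q & p k * y * p l != 0 >].
have link_refl k : link k k.
  apply/asboolP; exists 1; first exact: fd_one.
  by rewrite mulr1 (proj_idem (pP k)) (proj1 (pM k)).
have link_sym k l : link k l -> link l k.
  move=> /asboolP[y yQ y0]; apply/asboolP; exists (y ^t*); first exact: fd_star.
  apply: contraNneq y0 => y0.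
  have := congr1 (fun z : Mx => z ^t*) y0.
  by rewrite !starM_mx star0 trmxCK !(proj_star (pP _)) mulrA => ->.
have link_trans l k m : link k l -> link l m -> link k m.
  move=> /asboolP[y yQ y0] /asboolP[z zQ z0]; apply/asboolP.
  have [v [vQ vv vsv pv]] := partial_isometry (pP k) (pP l) (pM k) (pM l) yQ y0.
  exists (v * (p l * z)); first by rewrite !fdM ?(proj_in (pP _)).
  apply: contraNneq z0 => z0.
  have vz : v * (p l * z * p m) = 0 by rewrite -[RHS]z0 !mulrA pv.
  have -> : p l * z * p m = v ^t* * (v * (p l * z * p m)).
    by rewrite mulrA vsv !mulrA (proj_idem (pP l)).
  by rewrite vz mulr0.
have [blk [blk_link blk_min]] : exists blk : 'I_(size s) -> 'I_(size s),
    (forall k, link k (blk k)) /\ forall k l, link k l -> (blk k <= l)%N.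
  exists (fun k => [arg min_(l < k | link k l) l]).
  by split=> [k|k l kl]; case: arg_minnP => // i _; apply.
have blk_eq k l : link k l -> blk k = blk l.
  move=> kl; apply/val_inj/anti_leq/andP; split; apply: blk_min.
    exact: link_trans kl (blk_link l).
  exact: link_trans (link_sym _ _ kl) (blk_link k).
have link_blk k l : blk k = blk l -> link k l.
  by move=> kl; apply: link_trans (blk_link k) _; rewrite kl link_sym.
have [k|v vP] := @boolp.choice _ _ (fun k w => [/\ w \in Q, w * w ^t* = p k,
    w ^t* * w = p (blk k) & p k * w = w]).
  have /asboolP[y yQ y0] := blk_link k.
  exact: (partial_isometry _ _ _ _ yQ y0).
have vQ k : v k \in Q by case: (vP k).
have vp k : v k * p (blk k) = v k.
  by have [_ vv <- pv] := vP k; rewrite mulrA vv.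
have vp_star k : (v k) ^t* = p (blk k) * (v k) ^t*.
  by rewrite -{1}(vp k) starM_mx (proj_star (pP _)).
have pv k : p k * v k = v k by case: (vP k).
have vsp k : (v k) ^t* * p k = (v k) ^t*.
  by rewrite -[p k](proj_star (pP k)) -starM_mx pv.
exists (size s), blk, (fun k l => v k * (v l) ^t*); split.
- by move=> k l _; rewrite fdM ?fd_star.
- move=> k l m kl lm; rewrite !mulrA -[v k * _ * _]mulrA.
  by have [_ _ -> _] := vP l; rewrite -kl vp.
- move=> k l l' m ll'; rewrite mulrA -[v k * _ * _]mulrA.
  have -> : (v l) ^t* * v l' = 0.
    by rewrite -vsp -(pv l') mulrA -[_ * p l * _]mulrA po // mulr0 mul0r.
  by rewrite mulr0 mul0r.
- by move=> k l; rewrite starM_mx trmxCK.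
- by rewrite -[RHS]p_sum; apply: eq_bigr => k _; case: (vP k).
- by move=> k; have [_ -> _ _] := vP k; case: (pM k).
move=> x xQ.
have [[k l] /=|a aP] := @boolp.choice _ _ (fun kl a => blk kl.1 = blk kl.2 ->
    p kl.1 * x * p kl.2 = a *: (v kl.1 * (v kl.2) ^t*)).
  have [kl|kl] := eqVneq (blk k) (blk l); last first.
    by exists 0 => /eqP; rewrite (negPf kl).
  have [_ /(_ ((v k) ^t* * x * v l))[|a aE]] := pM (blk k).
    by rewrite !fdM ?fd_star ?vQ.
  exists a => _; have [_ <- _ _] := vP k; have [_ <- _ _] := vP l.
  transitivity (v k * (p (blk k) * ((v k) ^t* * x * v l) * p (blk k)) * (v l) ^t*).
    by rewrite !mulrA vp -[_ * p (blk k) * _]mulrA kl -vp_star.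
  by rewrite aE -scalerAr -scalerAl vp.
exists (fun k l => a (k, l)).
have -> : x = \sum_(kl : 'I_(size s) * 'I_(size s)) p kl.1 * x * p kl.2.
  rewrite -(pair_big xpredT xpredT (fun k l => p k * x * p l)) /=.
  rewrite -{1}[x]mul1r -{1}[x]mulr1 -p_sum mulr_suml.
  by apply: eq_bigr => k _; rewrite mulrA mulr_sumr.
rewrite (bigID (fun kl => blk kl.1 == blk kl.2)) /= addrC big1 ?add0r => [|kl].
  by apply: eq_bigr => -[k l] /eqP kl; apply: aP.
move=> /eqP nkl; apply: contra_notP nkl => /eqP nkl.
by apply: blk_eq; apply/asboolP; exists x.
Qed.

Section Basis.
Variables (r : nat) (blk : 'I_r -> 'I_r) (e : 'I_r -> 'I_r -> Mx).
Hypothesis mu : matrix_units blk e.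

Lemma matrix_units_trace_gt0 k : 0 < tr (e k k).
Proof.
apply: projection_trace_gt0; last exact: (mu_neq0 mu).
by split; rewrite ?(mu_in mu) ?(mu_mul mu) ?(mu_star mu).
Qed.

Lemma matrix_units_offdiag k l : blk k = blk l -> k != l -> tr (e k l) = 0.
Proof.
move=> kl nkl; rewrite -(mu_mul mu (l := k)) // mxtraceM (mu_mul0 mu) ?linear0 //.
by rewrite eq_sym.
Qed.

Lemma matrix_units_dot k l k' l' : blk k = blk l -> blk k' = blk l' ->
  tr (e l k * e k' l') = ((k == k') && (l == l'))%:R * tr (e l l).
Proof.
move=> kl kl'; have [kk'|nkk'] := eqVneq k k'; last first.
  by rewrite (mu_mul0 mu) // linear0 mul0r.
move: kl'; rewrite -kk' => kl'; rewrite (mu_mul mu) //.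
have [<-|nll'] := eqVneq l l'; first by rewrite mul1r.
by rewrite matrix_units_offdiag ?mul0r // -kl.
Qed.

(** The normalised matrix units form an orthonormal basis, so that the dimension counts
    the pairs of indices in a common block. *)
Lemma matrix_units_frame : exists2 h, frame tr Q h &
  \sum_(b <- h) tr (b ^t* * b) = #|[pred kl | blk kl.1 == blk kl.2]|%:R.
Proof.
pose X := [pred kl | blk kl.1 == blk kl.2].
pose s l := (sqrtC (tr (e l l)))^-1.
have s2 l : s l * s l * tr (e l l) = 1.
  have s0 : sqrtC (tr (e l l)) != 0.
    by rewrite sqrtC_eq0 gt_eqF // matrix_units_trace_gt0.
  by rewrite -[X in _ * X = _]sqrtCK expr2 -mulrA /s mulKf // mulVf.
have sR l : (s l)^* = s l.
  apply/CrealP/ger0_real; rewrite invr_ge0 sqrtC_ge0.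
  exact/ltW/matrix_units_trace_gt0.
pose b (kl : 'I_r * 'I_r) := s kl.2 *: e kl.1 kl.2.
have dotb kl x : tr ((b kl) ^t* * x) = s kl.2 * tr (e kl.2 kl.1 * x).
  by rewrite /b starZ sR (mu_star mu) -scalerAl mxtraceZ.
exists [seq b kl | kl <- enum X].
  split=> [_ /mapP[[k l] kl ->]|x xQ].
    by move: kl; rewrite mem_enum => /eqP kl; rewrite memvZ ?(mu_in mu).
  have [a xE] := mu_span mu xQ.
  rewrite big_map big_enum_cond /= {1}xE; apply: eq_big => [kl|[k l] /eqP /= kl].
    by rewrite andbT.
  rewrite dotb /= /b /= scalerA; congr (_ *: _).
  suff -> : tr (e l k * x) = a k l * tr (e l l).
    by rewrite -[LHS]mulr1 -(s2 l); ring.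
  rewrite xE [e l k * _]mulr_sumr (linear_sum (@mxtrace C n.+1)) /=.
  rewrite (bigD1 (k, l)) /=; last exact/eqP.
  rewrite big1 ?addr0 => [|[k' l'] /= /andP[/eqP kl' nkl]].
    by rewrite -scalerAr mxtraceZ matrix_units_dot // !eqxx mul1r.
  rewrite -scalerAr mxtraceZ matrix_units_dot //.
  by rewrite -xpair_eqE eq_sym (negPf nkl) mul0r mulr0.
rewrite big_map big_enum_cond /= -sum1_card natr_sum /=.
apply: eq_big => [kl|[k l] /andP[/eqP /= kl _]]; first by rewrite andbT.
rewrite dotb /b /= -scalerAr mxtraceZ matrix_units_dot // !eqxx mul1r.
by rewrite mulrA s2.
Qed.
End Basis.
End MatrixUnits.

(** * Full matrix algebras as tracial von Neumann algebras *)
Section Completeness.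
Variable R : realType.
Local Notation C := R[i].

(** The limit is the supremum of the numbers that are eventually below the sequence. *)
Lemma cauchy_real (x : nat -> R) :
  (forall eps, 0 < eps -> exists k, forall p q, (k <= p)%N -> (k <= q)%N ->
     `|x p - x q| < eps) ->
  exists l, forall eps, 0 < eps -> exists k, forall p, (k <= p)%N ->
     `|x p - l| < eps.
Proof.
move=> xC; pose E := [set y | exists k, forall p, (k <= p)%N -> y <= x p].
have near k eps p : (forall p q, (k <= p)%N -> (k <= q)%N ->
    `|x p - x q| < eps) -> (k <= p)%N -> x k - eps <= x p <= x k + eps.
  by move=> /(_ p k) + kp => /(_ kp (leqnn k))/ltW; rewrite ler_distl.
have lowE k eps : (forall p q, (k <= p)%N -> (k <= q)%N ->
    `|x p - x q| < eps) -> E (x k - eps).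
  by move=> kP; exists k => p kp; have /andP[] := near _ _ _ kP kp.
have ubE k eps : (forall p q, (k <= p)%N -> (k <= q)%N ->
    `|x p - x q| < eps) -> ubound E (x k + eps).
  move=> kP y [k' yk']; apply: le_trans (yk' _ (leq_maxr k k')) _.
  by have /andP[] := near _ _ _ kP (leq_maxl k k').
exists (sup E) => eps eps0; have e0 : 0 < eps / 3 by rewrite divr_gt0.
have [k kP] := xC _ e0; exists k => p kp.
have supE : has_sup E.
  by split; [exists (x k - eps / 3); apply: lowE | exists (x k + eps / 3); apply: ubE].
have h1 : x k - eps / 3 <= sup E by apply: (ub_le_sup supE.2); apply: lowE.
have h2 : sup E <= x k + eps / 3 by apply: (ge_sup supE.1); apply: ubE.
have /andP[h3 h4] := near _ _ _ kP kp.
rewrite ltr_distl; lra.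
Qed.

Lemma cauchy_complex (x : nat -> C) :
  (forall eps : R, 0 < eps -> exists k, forall p q, (k <= p)%N -> (k <= q)%N ->
     `|x p - x q| < eps%:C%C) ->
  exists l, forall eps : R, 0 < eps -> exists k, forall p, (k <= p)%N ->
     `|x p - l| < eps%:C%C.
Proof.
move=> xC.
have reB (z w : C) : complex.Re (z - w) = complex.Re z - complex.Re w.
  by case: z w => [a b] [c d].
have imB (z w : C) : complex.Im (z - w) = complex.Im z - complex.Im w.
  by case: z w => [a b] [c d].
have leIm (z : C) : (`|complex.Im z|)%:C%C <= `|z|.
  rewrite normc_def lecR -sqrtr_sqr ler_wsqrtr // lerDr sqr_ge0 //.
have [a aP] : exists a, forall eps, 0 < eps -> exists k, forall p, (k <= p)%N ->
    `|complex.Re (x p) - a| < eps.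
  apply: cauchy_real => eps /xC[k kP]; exists k => p q kp kq.
  by rewrite -ltcR -reB (le_lt_trans (normc_ge_Re _)) ?kP.
have [b bP] : exists b, forall eps, 0 < eps -> exists k, forall p, (k <= p)%N ->
    `|complex.Im (x p) - b| < eps.
  apply: cauchy_real => eps /xC[k kP]; exists k => p q kp kq.
  by rewrite -ltcR -imB (le_lt_trans (leIm _)) ?kP.
exists (a +i* b)%C => eps eps0.
have e0 : 0 < eps / 2 by rewrite divr_gt0.
have [[k1 k1P] [k2 k2P]] := (aP _ e0, bP _ e0).
exists (maxn k1 k2) => p; rewrite geq_max => /andP[/k1P h1 /k2P h2].
have -> : x p - (a +i* b)%C = (complex.Re (x p) - a)%:C%C +
    'i%C * (complex.Im (x p) - b)%:C%C by rewrite [LHS]complexE reB imB.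
apply: le_lt_trans (ler_normD _ _) _; rewrite normrM.
have -> : `|'i%C| = 1 :> C by rewrite normc_def /= expr0n expr1n add0r sqrtr1.
rewrite mul1r.
have nR (y : R) : `|y%:C%C| = (`|y|)%:C%C by rewrite normc_def /= expr0n addr0 sqrtr_sqr.
rewrite !nR -rmorphD ltcR; lra.
Qed.
End Completeness.

Section RowSpace.
Variables (R : realType) (m : nat).
Local Notation C := R[i].
Local Notation V := 'rV[C]_m.+1.

Lemma dotmx_sum (u v : V) : dotmx u v = \sum_j u 0 j * (v 0 j)^*.
Proof. by rewrite dotmxE mxE; apply: eq_bigr => j _; rewrite !mxE. Qed.

Lemma row_complete (u : nat -> V) :
  (forall eps : R, 0 < eps -> exists k : nat, forall p q : nat,
     (k <= p)%N -> (k <= q)%N -> dotmx (u p - u q) (u p - u q) < eps%:C%C) ->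
  exists l : V, forall eps : R, 0 < eps -> exists k : nat,
    forall p : nat, (k <= p)%N -> dotmx (u p - l) (u p - l) < eps%:C%C.
Proof.
move=> uC.
have coord_le (w : V) j : `|w 0 j| ^+ 2 <= dotmx w w.
  rewrite dotmx_sum (bigD1 j) //= -normCK lerDl.
  by apply: sumr_ge0 => i _; rewrite mul_conjC_ge0.
have [j|l lP] := @boolp.choice _ _ (fun j l => forall eps : R, 0 < eps ->
    exists k, forall p, (k <= p)%N -> `|u p 0 j - l| < eps%:C%C).
  apply: cauchy_complex => eps eps0.
  have [k kP] := uC (eps ^+ 2) (exprn_gt0 _ eps0); exists k => p q kp kq.
  have := le_lt_trans (coord_le (u p - u q) j) (kP _ _ kp kq).
  rewrite !mxE rmorphXn ltr_pXn2r ?nnegrE //= ler0c; exact: ltW.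
exists (\row_j l j) => eps eps0.
(* With a bound below 1 the square of the bound is at most the bound. *)
pose d := Num.min 1 (eps / m.+1%:R).
have d0 : 0 < d by rewrite /d lt_min ltr01 divr_gt0 ?ltr0n.
have d1 : d ^+ 2 <= eps / m.+1%:R.
  rewrite expr2 (le_trans (ler_piMr _ _)) ?ge_min ?lexx ?orbT //.
  exact: ltW.
have [k kP] := @boolp.choice _ _ _ (fun j => lP j d d0).
exists (\max_j k j) => p kp; rewrite dotmx_sum.
apply: (@lt_le_trans _ _ (\sum_(j < m.+1) (d%:C%C) ^+ 2)).
  apply: ltr_sum => [|j _].
    by apply/hasP; exists ord0; rewrite ?mem_index_enum.
  rewrite -normCK ltr_pXn2r ?nnegrE //= ?ler0c ?(ltW d0) // !mxE.
  by apply: kP; apply: leq_trans kp; apply: leq_bigmax.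
rewrite sumr_const card_ord -rmorphXn -rmorphMn lecR -mulr_natl.
by rewrite -ler_pdivlMl ?ltr0n // mulrC.
Qed.

Definition row_hilbert : hilbertSpace R :=
  @HilbertSpace R V (@dotmx C m.+1) row_complete.
End RowSpace.

Section MatrixAlgebra.
Variables (R : realType) (m : nat).
Local Notation C := R[i].
Local Notation V := (row_hilbert R m).
Local Notation L := 'M[C]_m.+1.
Local Notation rV := 'rV[C]_m.+1.
Implicit Types (x y : L) (xi eta : rV).

Definition mx_rep x (xi : V) : V := (xi : rV) *m x^T.

Lemma mx_rep_linear (a : C) x y (xi : V) :
  mx_rep (a *: x + y) xi = a *: mx_rep x xi + mx_rep y xi.
Proof. by rewrite /mx_rep linearP mulmxDr -scalemxAr. Qed.

Lemma mx_rep_mul x y (xi : V) : mx_rep (x * y) xi = mx_rep x (mx_rep y xi).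
Proof. by rewrite /mx_rep -[x * y]/(x *m y) trmx_mul mulmxA. Qed.

Lemma mx_rep_one (xi : V) : mx_rep 1 xi = xi.
Proof. by rewrite /mx_rep -[1]/(1%:M) tr_scalar_mx mulmx1. Qed.

Lemma mx_rep_star x (xi eta : V) :
  hs_dot V (mx_rep x xi) eta = hs_dot V xi (mx_rep (x ^t*) eta).
Proof.
rewrite /= !dotmxE /mx_rep [in RHS]trmx_mul trmxK map_mxM.
have -> : map_mx conjC (x ^t*) = x^T.
  by apply/matrixP => i j; rewrite !mxE conjCK.
by rewrite mulmxA.
Qed.

Lemma mx_rep_inj : injective mx_rep.
Proof.
move=> x y xy; apply: (can_inj (@trmxK _ _ _)); apply/row_matrixP => i.
by rewrite !rowE; have := congr1 (fun f => f (delta_mx 0 i : V)) xy.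
Qed.

(** Expand [xi] in the standard basis and apply [q (eta + zeta) <= 2 * (q eta + q zeta)]
    once for each coordinate; the constant is crude. *)
Lemma psd_bound (H : L) : (forall xi, 0 <= (xi *m H *m xi ^t*) 0 0) ->
  forall xi, (xi *m H *m xi ^t*) 0 0 <= 2 ^+ m.+1 * \tr H * dotmx xi xi.
Proof.
move=> H0 xi; pose q (eta : rV) := (eta *m H *m eta ^t*) 0 0.
have qD eta zeta : q (eta + zeta) <= 2 * (q eta + q zeta).
  rewrite -subr_ge0; have -> : 2 * (q eta + q zeta) - q (eta + zeta) = q (eta - zeta).
    rewrite /q !linearD /= !map_mxD !mulmxDl !mulmxDr linearN /= map_mxN.
    by rewrite !mulNmx !mulmxN !mxE; ring.
  exact: H0.
have qsum (s : seq 'I_m.+1) : q (\sum_(j <- s) xi 0 j *: delta_mx 0 j) <=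
    2 ^+ size s * \sum_(j <- s) q (xi 0 j *: delta_mx 0 j).
  elim: s => [|j s IH]; first by rewrite !big_nil /q !mul0mx mxE mulr0.
  rewrite !big_cons (le_trans (qD _ _)) //= exprS -mulrA ler_pM2l ?ltr0n //.
  rewrite mulrDr lerD // ler_peMl ?H0 // exprn_ege1 //.
  by rewrite ler1n.
have qdelta j : q (xi 0 j *: delta_mx 0 j) = `|xi 0 j| ^+ 2 * H j j.
  rewrite /q linearZ /= map_mxZ -!scalemxAl -scalemxAr -rowE mxE mxE.
  rewrite mulrA -normCK; congr (_ * _).
  rewrite trmx_delta map_delta_mx -colE !mxE //.
have Hjj j : 0 <= H j j.
  have := H0 (delta_mx 0 j); rewrite -rowE trmx_delta map_delta_mx -colE !mxE //.
rewrite [X in X *m _ *m _]row_sum_delta [X in _ *m X ^t*]row_sum_delta.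
apply: le_trans (qsum (index_enum _)) _.
have -> : size (index_enum 'I_m.+1) = m.+1.
  by rewrite /index_enum -enumT size_enum_ord.
rewrite -mulrA ler_pM2l ?exprn_gt0 ?ltr0n //.
rewrite mulr_suml; apply: ler_sum => j _; rewrite qdelta mulrC ler_wpM2l //.
rewrite dotmx_sum (bigD1 j) //= -normCK lerDl.
by apply: sumr_ge0 => i _; rewrite mul_conjC_ge0.
Qed.

(** On a finite-dimensional space every linear operator is a matrix, and every matrix is
    bounded. *)
Lemma mx_bicommutant :
  range mx_rep = commutant (commutant (range mx_rep)).
Proof.
apply/seteqP; split=> [_ [x _ <-]|T [[Tlin _] _]].
  split; last by move=> S [_ SC] xi; apply/esym/(SC (mx_rep x)); exists x.
  split; first by move=> a xi eta; rewrite /mx_rep mulmxDl -scalemxAl.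
  pose H := x^T *m x^T ^t*.
  have HE (xi : rV) : (xi *m H *m xi ^t*) 0 0 = dotmx (xi *m x^T) (xi *m x^T).
    by rewrite dotmxE trmx_mul map_mxM !mulmxA.
  have H0 (xi : rV) : 0 <= (xi *m H *m xi ^t*) 0 0 by rewrite HE dnorm_ge0.
  have trH : 0 <= 2 ^+ m.+1 * \tr H.
    apply: mulr_ge0; first by rewrite exprn_ge0 ?ler0n.
    apply: sumr_ge0 => j _; have := H0 (delta_mx 0 j).
    by rewrite -rowE trmx_delta map_delta_mx -colE !mxE.
  exists (complex.Re (2 ^+ m.+1 * \tr H)) => xi /=.
  by rewrite RRe_real ?ger0_real // -HE psd_bound.
pose Tl : {linear rV -> rV} := HB.pack (T : rV -> rV)
  (GRing.isLinear.Build _ _ _ _ (T : rV -> rV) Tlin).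
exists (lin1_mx Tl)^T => //; apply/funext => xi.
by rewrite /mx_rep trmxK mul_rV_lin1.
Qed.

Definition mx_vna : vonNeumannAlgebra R :=
  VonNeumannAlgebra mx_rep_linear mx_rep_mul mx_rep_one mx_rep_star mx_rep_inj
    mx_bicommutant.

Definition normalized_trace x : C^o := m.+1%:R^-1 * \tr x.

Fact normalized_trace_linear : linear normalized_trace.
Proof. by move=> a x y; rewrite /normalized_trace linearP /= mulrDr mulrCA. Qed.

Definition mx_tr : {scalar L} :=
  HB.pack normalized_trace (GRing.isLinear.Build _ _ _ _ normalized_trace normalized_trace_linear).

Local Notation mx_le := (@vn_le R mx_vna).

Lemma mx_le_form x y xi : mx_le x y -> 0 <= (xi *m (y - x)^T *m xi ^t*) 0 0.
Proof. by move=> /(_ xi); rewrite /= dotmxE. Qed.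

Lemma mx_le_trace x y : mx_le x y -> normalized_trace x <= normalized_trace y.
Proof.
move=> xy; rewrite /normalized_trace ler_pM2l ?invr_gt0 ?ltr0n // -subr_ge0 -linearB /=.
apply: sumr_ge0 => j _; have := mx_le_form (delta_mx 0 j) xy.
by rewrite -rowE trmx_delta map_delta_mx -colE !mxE.
Qed.

(** By [psd_bound], the trace of the positive matrix [y - x] controls its quadratic form. *)
Lemma mx_le_scalar x y (eps : C) : mx_le x y ->
  2 ^+ m.+1 * \tr (y - x) <= eps -> mx_le y (x + eps *: 1).
Proof.
move=> xy le_eps xi; have := psd_bound (fun xi => mx_le_form xi xy) xi.
rewrite mxtrace_tr => bound.
rewrite /= dotmxE /mx_rep.
have -> : (x + eps *: 1 - y)^T = eps *: 1 - (y - x)^T.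
  by apply/matrixP => i j; rewrite !mxE eq_sym; ring.
rewrite mulmxBr mulmxBl -scalemxAr -[1]/(1%:M) mulmx1 -scalemxAl mxE.
rewrite [X in 0 <= _ + X]mxE subr_ge0 (le_trans bound) // mxE -dotmxE.
by rewrite ler_wpM2r ?dnorm_ge0.
Qed.

(** Choose [a] in the directed set with trace close to the supremum of the traces.  Any
    element of the set lies below some [c] above [a] with [c - a] of small trace, so
    [a] plus a small scalar bounds the whole set, hence also its supremum [x]. *)
Lemma mx_tr_normal : @vn_normal R mx_vna mx_tr.
Proof.
move=> D x [a0 Da0] Dsa Ddir xsa [xub xleast] r rub.
have trR (a : L) : a ^t* = a -> (complex.Re (normalized_trace a))%:C%C = normalized_trace a.
  move=> aa; rewrite RRe_real // /normalized_trace realM ?realV ?realn //.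
  by apply/CrealP; rewrite -mxtrace_star aa.
pose E := [set complex.Re (normalized_trace a) | a in D].
have ubE : ubound E r.
  by move=> _ [a Da <-]; rewrite -lecR (trR _ (Dsa a Da)); apply: rub.
have supE : has_sup E.
  by split; [exists (complex.Re (normalized_trace a0)), a0 | exists r].
(* The factor lost when the normalized trace of a positive matrix is used to
   bound its quadratic form. *)
pose K : R := 2 ^+ m.+1 * m.+1%:R.
have K0 : 0 < K by rewrite mulr_gt0 ?exprn_gt0 ?ltr0n.
rewrite -[mx_tr x]/(normalized_trace x) -(trR _ xsa) lecR; apply/ler_addgt0Pr => eps eps0.
have e0 : 0 < eps / K by rewrite divr_gt0.
have [_ [a Da <-] sup_lt] := sup_adherent e0 supE.
have ub b : D b -> mx_le b (a + eps%:C%C *: 1).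
  move=> Db; have [c [Dc ac bc]] := Ddir a b Da Db.
  have ca : mx_le c (a + eps%:C%C *: 1).
    apply: mx_le_scalar => //.
    have -> : \tr (c - a : L) = m.+1%:R * (normalized_trace c - normalized_trace a).
      by rewrite linearB /= mulrBr !mulVKf // pnatr_eq0.
    rewrite -(trR _ (Dsa c Dc)) -(trR _ (Dsa a Da)) mulrA -rmorphB.
    have -> : 2 ^+ m.+1 * m.+1%:R = K%:C%C :> C.
      by rewrite /K rmorphM rmorphXn !rmorph_nat.
    rewrite -rmorphM lecR.
    have : complex.Re (normalized_trace c) <= sup E.
      by apply: (ub_le_sup supE.2); exists c.
    rewrite -ler_pdivlMl // mulrC; lra.
  move=> xi; have := addr_ge0 (bc xi) (ca xi).
  by rewrite -linearDl -vn_repD addrC subrKA.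
have asa : (a + eps%:C%C *: 1 : L) ^t* = a + eps%:C%C *: 1.
  rewrite starD starZ star1 [a ^t*](Dsa a Da); congr (_ + _ *: _).
  by apply/CrealP; rewrite complex_real.
have := mx_le_trace (xleast _ asa ub).
rewrite -(trR _ xsa) -(trR _ asa) lecR => /le_trans; apply.
have -> : complex.Re (normalized_trace (a + eps%:C%C *: 1)) = complex.Re (normalized_trace a) + eps.
  rewrite /normalized_trace linearD mulrDr linearZ /= mxtrace1 mulrCA mulVf ?pnatr_eq0 //.
  by rewrite mulr1; case: (_ * _).
by rewrite lerD2r; apply: ubE; exists a.
Qed.

Lemma mx_tr_unit : mx_tr 1 = 1.
Proof. by rewrite /= /normalized_trace mxtrace1 mulVf // pnatr_eq0. Qed.

Lemma mx_tr_pos x : 0 <= mx_tr (x ^t* * x).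
Proof. by rewrite mulr_ge0 ?invr_ge0 ?ler0n // mxtrace_starM_ge0. Qed.

Lemma mx_tr_faithful x : mx_tr (x ^t* * x) = 0 -> x = 0.
Proof.
move/eqP; rewrite mulf_eq0 invr_eq0 pnatr_eq0 => /eqP.
exact: mxtrace_starM_eq0.
Qed.

Lemma mx_tr_tracial x y : mx_tr (x * y) = mx_tr (y * x).
Proof. by rewrite /= /normalized_trace mxtraceM. Qed.

Definition mx_tva : tracialVNA R :=
  @TracialVNA R mx_vna mx_tr mx_tr_unit mx_tr_pos mx_tr_faithful mx_tr_tracial
    mx_tr_normal.

Lemma mx_findim : vn_findim mx_tva.
Proof.
pose b := vbasis {: L}; exists (\dim {: L}), (fun i => b`_i) => x.
by exists (fun i => coord b i x); apply: coord_vbasis; apply: memvf.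
Qed.
End MatrixAlgebra.

(** * Weyl matrix units *)
Section Weyl.
Variables (R : realType).
Local Notation C := R[i].

(** The polynomial [X^q - 1] splits over a closed field and is separable. *)
Lemma primitive_root_exists q : (0 < q)%N -> exists w : C, q.-primitive_root w.
Proof.
move=> q0; pose p : {poly C} := 'X^q - 1.
have [r Dp] := closed_field_poly_normal p.
rewrite (monicP _) ?monicXnsubC // scale1r in Dp.
have rn1 : all q.-unity_root r.
  by apply/allP => z; rewrite -root_prod_XsubC -Dp.
have sz_r : (q < (size r).+1)%N.
  by rewrite -(size_prod_XsubC r id) -Dp size_XnsubC.
have [|z] := hasP (has_prim_root q0 rn1 _ sz_r); last by exists z.
by rewrite -separable_prod_XsubC -Dp separable_Xn_sub_1 // pnatr_eq0 -lt0n.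
Qed.

Lemma primitive_root_neq0 q (w : C) : q.-primitive_root w -> w != 0.
Proof. by move=> pw; rewrite (prim_root_eq0 pw) -lt0n (prim_order_gt0 pw). Qed.

Lemma primitive_root_conj q (w : C) : q.-primitive_root w -> w^* = w^-1.
Proof.
move=> pw; have q0 := prim_order_gt0 pw.
have w1 : `|w| = 1.
  apply/eqP; rewrite -(@pexpr_eq1 _ _ q) //; last by rewrite -normrX (prim_expr_order pw) normr1.
by rewrite invC_norm w1 expr1n invr1 mul1r.
Qed.

(** Orthogonality of the characters of the cyclic group of order [q]. *)
Lemma primitive_root_ortho q (w : C) k l : q.-primitive_root w ->
  (k < q)%N -> (l < q)%N ->
  \sum_(s < q) w ^+ (s * k) * (w ^+ (s * l))^* = (k == l)%:R * q%:R.
Proof.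
move=> pw kq lq; have w0 := primitive_root_neq0 pw.
pose z := w ^+ k / w ^+ l.
have -> : \sum_(s < q) w ^+ (s * k) * (w ^+ (s * l))^* = \sum_(s < q) z ^+ s.
  apply: eq_bigr => s _; rewrite rmorphXn /= (primitive_root_conj pw) /z.
  by rewrite exprMn exprVn exprVn -!exprM mulnC [(l * s)%N]mulnC.
have [kl|kl] := eqVneq k l.
  rewrite (eq_bigr (fun => 1)) ?sumr_const ?card_ord ?mul1r // => s _.
  by rewrite /z kl divff ?expr1n // expf_neq0.
have z1 : z - 1 != 0.
  rewrite subr_eq0; apply: contra kl => /eqP z1.
  have : w ^+ k == w ^+ l.
    by rewrite -[w ^+ k](divfK (expf_neq0 l w0)) -/z z1 mul1r.
  by rewrite (eq_prim_root_expr pw) !modn_small.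
apply: (mulfI z1); rewrite -subrX1 mul0r mulr0 /z exprMn exprVn -!exprM.
rewrite mulnC [(l * q)%N]mulnC !exprM (prim_expr_order pw) !expr1n divr1.
by rewrite subrr.
Qed.

Variable m : nat.
Local Notation L := 'M[C]_m.+1.

(** The unit at the position [c, c'] of ['M_q], repeated along the diagonal of a
    larger matrix: row indices are read as a block number and a residue mod [q]. *)
Definition block_unit q c c' : L := \matrix_(u, v)
  [&& u %% q == c, v %% q == c' & u %/ q == v %/ q]%N%:R.

Lemma block_unit_star q c c' : (block_unit q c c') ^t* = block_unit q c' c.
Proof.
apply/matrixP => u v; rewrite !mxE conjC_nat andbCA [(v %/ q)%N == _]eq_sym.
by [].
Qed.

Lemma block_unit_mul q c c' d d' : (q %| m.+1)%N -> (c' < q)%N ->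
  block_unit q c c' * block_unit q d d' = (c' == d)%:R *: block_unit q c d'.
Proof.
move=> qm c'q; apply/matrixP => u v.
rewrite -[_ * block_unit q d d']/(_ *m _) !mxE.
(* The only row index in the block of [u] with residue [c']; it stays in range
   because [q] divides the size. *)
have ltm : (u %/ q * q + c' < m.+1)%N.
  have q0 : (0 < q)%N by apply: leq_trans c'q.
  have uq : (u %/ q < m.+1 %/ q)%N.
    by rewrite ltn_divLR // [X in (_ < X)%N](divnK qm).
  apply: (@leq_trans ((u %/ q).+1 * q)); first by rewrite mulSn addnC ltn_add2r.
  by rewrite -[X in (_ <= X)%N](divnK qm) leq_mul2r uq orbT.
rewrite (bigD1 (Ordinal ltm)) //= big1 ?addr0 => [|w nw].
  have q0 : (0 < q)%N by apply: leq_trans c'q.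
  rewrite !mxE /= modnMDl (modn_small c'q) divnMDl // (divn_small c'q) addn0.
  by rewrite !eqxx -!natrM !mulnb /= andbT andbCA; do 3!case: (_ == _).
rewrite !mxE -natrM mulnb; case: eqP => //= _; case: eqP => //= wc'.
case: eqP => //= uw; case/eqP: nw; apply/val_inj => /=.
by rewrite uw -wc' -divn_eq.
Qed.

Lemma block_unit_sum q : (0 < q)%N -> \sum_(c < q) block_unit q c c = 1.
Proof.
move=> q0; apply/matrixP => u v; rewrite summxE !mxE.
rewrite (bigD1 (Ordinal (ltn_pmod u q0))) //= mxE eqxx /= big1 ?addr0 => [|c nc].
  congr _%:R; congr nat_of_bool; apply/andP/eqP => [[/eqP vu /eqP vq]|->].
    by apply/val_inj; rewrite /= (divn_eq u q) (divn_eq v q) vu vq.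
  by rewrite !eqxx.
rewrite mxE; case: eqP => // uc; case/eqP: nc; apply/val_inj.
by rewrite /= uc.
Qed.

Variables (q : nat) (w : C).
Hypotheses (pw : q.-primitive_root w) (qm : (q %| m.+1)%N).

(** The units [block_unit q k l] conjugated by the Weyl unitary made of a cyclic shift
    by [t] and of the diagonal of the powers of [w ^+ s]. *)
Definition weyl_unit s t k l : L := (w ^+ (s * k) * (w ^+ (s * l))^*) *:
  block_unit q ((k + t) %% q)%N ((l + t) %% q)%N.

Let q0 : (0 < q)%N. Proof. exact: prim_order_gt0 pw. Qed.

Lemma weyl_unit_star s t k l : (weyl_unit s t k l) ^t* = weyl_unit s t l k.
Proof.
by rewrite /weyl_unit starZ block_unit_star rmorphM /= conjCK mulrC.
Qed.

Lemma weyl_unit_mul s t k l l' j : (l < q)%N -> (l' < q)%N ->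
  weyl_unit s t k l * weyl_unit s t l' j = (l == l')%:R *: weyl_unit s t k j.
Proof.
move=> lq l'q; rewrite /weyl_unit -scalerAl -scalerAr block_unit_mul ?ltn_pmod //.
rewrite eqn_modDr (modn_small lq) (modn_small l'q) !scalerA.
case: eqP => [<-|]; last by rewrite !mulr0 mul0r.
congr (_ *: _); rewrite mulr1 mul1r.
suff e : (w ^+ (s * l))^* * w ^+ (s * l) = 1.
  by rewrite -mulrA [X in _ * X]mulrA e mul1r.
rewrite rmorphXn /= (primitive_root_conj pw) exprVn mulVf //.
by rewrite expf_neq0 // (primitive_root_neq0 pw).
Qed.

(** Averaging over the Weyl unitaries is the trace: the sum over [s] kills the
    off-diagonal units, and the sum over [t] runs through all diagonal ones. *)
Lemma weyl_unit_sum k l : (k < q)%N -> (l < q)%N ->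
  \sum_(s < q) \sum_(t < q) weyl_unit s t k l = ((k == l)%:R * q%:R) *: 1.
Proof.
move=> kq lq; rewrite exchange_big /=.
rewrite (eq_bigr (fun t : 'I_q => ((k == l)%:R * q%:R) *:
  block_unit q ((k + t) %% q)%N ((k + t) %% q)%N)) => [|t _].
  rewrite -scaler_sumr; congr (_ *: _); rewrite -[RHS](block_unit_sum q0).
  have inj : injective (fun t : 'I_q => Ordinal (ltn_pmod (k + t) q0)).
    move=> t t' /(congr1 val) /= /eqP; rewrite eqn_modDl !modn_small //.
    by move/eqP/val_inj.
  by rewrite [RHS](reindex_inj inj).
rewrite -scaler_suml primitive_root_ortho //.
by case: eqP => [->|] //; rewrite mul0r !scale0r.
Qed.
End Weyl.

(** * The Bell colouring *)
Section TensorClosure.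
Variables (R : realType) (n : nat) (L : tracialVNA R).
Local Notation C := R[i].
Local Notation Mx := 'M[C]_n.+1.
Variable M : {vspace Mx}.
Implicit Types (P Q : 'M[L]_n.+1).

Lemma in_tensor_tens x (l : L) : x \in M -> in_tensor M (tens x l).
Proof.
by move=> xM; exists 1%N, (fun=> x), (fun=> l); split=> //; rewrite big_ord1.
Qed.

Lemma in_tensor0 : in_tensor M (0 : 'M[L]_n.+1).
Proof.
exists 0%N, (fun=> 0), (fun=> 0); split; first by case.
by rewrite big_ord0.
Qed.

Lemma in_tensorD P Q : in_tensor M P -> in_tensor M Q -> in_tensor M (P + Q).
Proof.
move=> [k1 [m1 [l1 [m1M ->]]]] [k2 [m2 [l2 [m2M ->]]]].
exists (k1 + k2)%N,
  (fun i => match split i with inl j => m1 j | inr j => m2 j end),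
  (fun i => match split i with inl j => l1 j | inr j => l2 j end); split.
  by move=> i; case: split.
rewrite big_split_ord; congr (_ + _); apply: eq_bigr => i _.
  case: splitP => j /= e; first by rewrite (val_inj e : i = j).
  by have := ltn_ord i; rewrite e ltnNge leq_addr.
case: splitP => j /= e; last by rewrite (val_inj (addnI e) : i = j).
by have := ltn_ord j; rewrite -e ltnNge leq_addr.
Qed.

Lemma in_tensor_sum I (s : seq I) (p : pred I) (F : I -> 'M[L]_n.+1) :
  (forall i, p i -> in_tensor M (F i)) -> in_tensor M (\sum_(i <- s | p i) F i).
Proof. by move=> FM; apply: big_ind => //; [apply: in_tensor0|apply: in_tensorD]. Qed.

Lemma tens0r (x : Mx) : tens x (0 : L) = 0.
Proof. by apply/matrixP => i j; rewrite !mxE scaler0. Qed.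

Lemma tensDr (x : Mx) (l k : L) : tens x (l + k) = tens x l + tens x k.
Proof. by apply/matrixP => i j; rewrite !mxE scalerDr. Qed.

Lemma tens_sumr I (s : seq I) (p : pred I) (x : Mx) (F : I -> L) :
  tens x (\sum_(i <- s | p i) F i) = \sum_(i <- s | p i) tens x (F i).
Proof. exact: (big_morph (@tens R n L x) (tensDr x) (tens0r x)). Qed.

Lemma tens_sumr2 (I : finType) (p p' : pred I) (x : Mx) (F : I -> I -> L) :
  tens x (\sum_(i | p i) \sum_(j | p' j) F i j) =
  \sum_(i | p i) \sum_(j | p' j) tens x (F i j).
Proof. by rewrite tens_sumr; apply: eq_bigr => i _; rewrite tens_sumr. Qed.

Lemma tens_units_mul (I : finType) (B : pred I) (U : I -> I -> L)
    (a c : I -> I -> Mx) :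
  (forall k l l' j, B k -> B l -> B l' -> B j ->
     U k l * U l' j = (l == l')%:R *: U k j) ->
  (\sum_(k | B k) \sum_(l | B l) tens (a k l) (U k l)) *
  (\sum_(k | B k) \sum_(l | B l) tens (c k l) (U k l)) =
  \sum_(k | B k) \sum_(j | B j) tens (\sum_(l | B l) a k l * c l j) (U k j).
Proof.
move=> UU; rewrite mulr_suml; apply: eq_bigr => k Bk; rewrite mulr_suml.
transitivity (\sum_(l | B l) \sum_(j | B j) tens (a k l * c l j) (U k j)).
  apply: eq_bigr => l Bl; rewrite mulr_sumr (bigD1 l) //=.
  rewrite [X in _ + X]big1 ?addr0 => [|l' /andP[Bl' nl]].
    rewrite mulr_sumr; apply: eq_bigr => j Bj.
    by rewrite tensM UU // eqxx scale1r.
  rewrite mulr_sumr big1 // => j Bj.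
  by rewrite tensM UU // eq_sym (negPf nl) scale0r tens0r.
rewrite exchange_big; apply: eq_bigr => j _.
by rewrite tens_suml.
Qed.
End TensorClosure.

Section BlockColouring.
Variables (R : realType) (n : nat) (N M : fdVNA R n) (sNM : (N <= M)%VS).
Hypothesis fN : is_factor N.
Local Notation C := R[i].
Local Notation Mx := 'M[C]_n.+1.
Local Notation tr := (@mxtrace C n.+1).
Local Notation Q := (relcomm N M).
Variables (r : nat) (blk : 'I_r -> 'I_r) (e : 'I_r -> 'I_r -> Mx).
Hypothesis mu : matrix_units Q blk e.
Implicit Types (b k l : 'I_r) (x y : Mx).

Lemma mu_commutant k l : blk k = blk l -> e k l \in 'C(N)%VS.
Proof. by move=> kl; have /relcommP[] := mu_in mu kl. Qed.

Lemma comm_units_commutant x : x \in 'C(N)%VS ->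
  (forall k l, blk k = blk l -> x * e k l = e k l * x) -> x \in 'C(M)%VS.
Proof.
move=> xN xe; apply: (comm_generated fN sNM xN) => y yM yN.
have yQ : y \in Q by apply/relcommP.
have [a ->] := mu_span mu yQ; rewrite mulr_sumr mulr_suml.
by apply: eq_bigr => kl /eqP kl12; rewrite -scalerAr -scalerAl xe.
Qed.

Section OneBlock.
Variable b : 'I_r.
Local Notation B := [pred l | blk l == b].

(** [z] is the central projection of the block of [b], and [spread] is, up to a scale,
    the conditional expectation onto the commutant of that block. *)
Let z : Mx := \sum_(l | B l) e l l.
Let spread x : Mx := \sum_(j | B j) \sum_(l | B l) e j l * x * e l j.

Lemma block_eq k l : B k -> B l -> blk k = blk l.
Proof. by move=> /eqP -> /eqP ->. Qed.

Lemma block_center : z \in 'C(M)%VS.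
Proof.
apply: comm_units_commutant => [|k l kl].
  by apply: memv_suml => l _; apply: mu_commutant.
rewrite /z mulr_suml mulr_sumr; have [Bk|nBk] := boolP (B k).
  have Bl : B l by rewrite /= -kl.
  rewrite (bigD1 k) //= big1 ?addr0 => [|j /andP[_ jk]]; last exact: (mu_mul0 mu).
  rewrite [RHS](bigD1 l) //= [in RHS]big1 ?addr0 => [|j /andP[_ jl]].
    by rewrite !(mu_mul mu).
  by rewrite (mu_mul0 mu) // eq_sym.
have nBl : ~~ B l by rewrite /= -kl.
rewrite !big1 // => j Bj; rewrite (mu_mul0 mu) //.
  by apply: contraNneq nBl => ->.
by apply: contraNneq nBk => <-.
Qed.

Lemma spread_unit k j x : B k -> B j ->
  spread x * e k j = \sum_(l | B l) e k l * x * e l j.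
Proof.
move=> Bk Bj; rewrite /spread mulr_suml (bigD1 k) //= [X in _ + X]big1 ?addr0.
  rewrite mulr_suml; apply: eq_bigr => l Bl.
  by rewrite -mulrA (mu_mul mu) ?(block_eq Bl Bk) ?(block_eq Bk Bj).
move=> i /andP[Bi ik]; rewrite mulr_suml big1 // => l Bl.
by rewrite -mulrA (mu_mul0 mu) // mulr0.
Qed.

Lemma unit_spread k j x : B k -> B j ->
  e k j * spread x = \sum_(l | B l) e k l * x * e l j.
Proof.
move=> Bk Bj; rewrite /spread mulr_sumr (bigD1 j) //= [X in _ + X]big1 ?addr0.
  rewrite mulr_sumr; apply: eq_bigr => l Bl.
  by rewrite !mulrA (mu_mul mu) ?(block_eq Bk Bj) ?(block_eq Bj Bl).
move=> i /andP[Bi ij]; rewrite mulr_sumr big1 // => l Bl.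
by rewrite !mulrA (mu_mul0 mu) ?mul0r // eq_sym.
Qed.

Lemma spread_commutant x : x \in 'C(N)%VS -> spread x \in 'C(M)%VS.
Proof.
move=> xN; apply: comm_units_commutant => [|k l kl].
  apply: memv_suml => j Bj; apply: memv_suml => l Bl.
  by rewrite !(fdM (A := commutant_fdVNA N)) //= mu_commutant // (block_eq Bj Bl).
have [Bk|nBk] := boolP (B k).
  have Bl : B l by rewrite /= -kl.
  by rewrite spread_unit // unit_spread.
have nBl : ~~ B l by rewrite /= -kl.
rewrite /spread mulr_suml mulr_sumr !big1 // => j Bj.
  rewrite mulr_sumr big1 // => i _; rewrite !mulrA (mu_mul0 mu) ?mul0r //.
  by apply: contraNneq nBl => ->.
rewrite mulr_suml big1 // => i _; rewrite -mulrA (mu_mul0 mu) ?mulr0 //.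
by apply: contraNneq nBk => <-.
Qed.

(** For [y := spread x] the trace of [y ^t* * y] unfolds to a multiple of the
    Hilbert--Schmidt product of [x] with [z * y], which lies in the commutant of [M]. *)
Lemma spread_orthogonal x : x \in 'C(N)%VS ->
  hs_orthogonal 'C(M)%VS x -> spread x = 0.
Proof.
move=> xN xo; apply: mxtrace_starM_eq0.
have yC := spread_commutant xN; set y := spread x in yC *.
have ysC : y ^t* \in 'C(M)%VS by rewrite commutant_star.
have Me k l : B k -> B l -> e k l \in M.
  by move=> Bk Bl; have /relcommP[] := mu_in mu (block_eq Bk Bl).
transitivity (#|B|%:R * tr ((z * y) ^t* * x)); last first.
  by rewrite [tr _]xo ?mulr0 // (fdM (A := commutant_fdVNA M)) // block_center.
have zs : z ^t* = z.
  by rewrite /z star_sum; apply: eq_bigr => l _; rewrite (mu_star mu).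
rewrite starM_mx zs {2}/y /spread mulr_sumr (linear_sum tr) /=.
rewrite mulr_natl -sumr_const; apply: eq_bigr => j Bj.
move: (y ^t*) ysC => w /centvP wC.
rewrite mulr_sumr /z mulr_sumr mulr_suml !(linear_sum tr); apply: eq_bigr => l Bl.
have -> : w * (e j l * x * e l j) = w * (e j l * x) * e l j by rewrite mulrA.
rewrite [LHS]mxtraceM; congr (tr _).
have -> : e l j * (w * (e j l * x)) = w * (e l j * e j l) * x.
  by rewrite !mulrA (wC _ (Me _ _ Bl Bj)).
by rewrite (mu_mul mu) ?(block_eq Bl Bj) ?(block_eq Bj Bl).
Qed.
End OneBlock.

Local Notation block b := [pred l | blk l == b].
Local Notation X := [pred kl | blk kl.1 == blk kl.2].

Definition blk_size b := #|block b|.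
(** The Weyl unitaries shift cyclically, so that the indices of a block are renumbered
    from 0. *)
Definition blk_pos b k := index k (enum (block b)).

Lemma blk_size_gt0 k : (0 < blk_size (blk k))%N.
Proof. by apply/card_gt0P; exists k; rewrite inE. Qed.

Lemma blk_size_dvd k : (blk_size (blk k) %| r`!)%N.
Proof.
by rewrite dvdn_fact // blk_size_gt0 (leq_trans (max_card _)) ?card_ord.
Qed.

Lemma blk_pos_lt b k : blk k == b -> (blk_pos b k < blk_size b)%N.
Proof. by move=> kb; rewrite /blk_size cardE index_mem mem_enum. Qed.

Lemma blk_pos_inj b k l : blk k == b -> blk l == b ->
  (blk_pos b k == blk_pos b l) = (k == l).
Proof.
move=> kb lb; apply/eqP/eqP => [kl|-> //].
by apply: (index_inj k _ _ kl); rewrite mem_enum.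
Qed.

Lemma sum_blk_pos (W : nmodType) b (F : nat -> W) :
  \sum_(k | blk k == b) F (blk_pos b k) = \sum_(i < blk_size b) F i.
Proof.
transitivity (\sum_(k <- enum (block b)) F (blk_pos b k)).
  by rewrite big_enum.
rewrite (big_nth b) -cardE big_mkord /=.
apply: eq_bigr => i _; congr (F _); rewrite /blk_pos index_uniq ?enum_uniq //.
by rewrite -cardE.
Qed.

(** The colours are the pairs [(s, t)] of indices in a common block.  The projection
    [P s t] is, on that block, the maximally entangled (Bell) projection of the
    units [e k l] with the Weyl units twisted by [(s, t)], and it vanishes on the
    other blocks.  Compressing [x] by it replaces [x] by [spread x], which is 0 for
    [x] orthogonal to the commutant of [M]; and the Bell projections of one block
    add up to the unit of that block by [weyl_unit_sum]. *)
Theorem bell_colouring : exists m,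
  colourable (commutant_graph sNM) (mx_tva R m) #|X|.
Proof.
(* Any size divisible by the size of every block will do. *)
exists (r`!).-1; set L := mx_tva R _.
have mE : (r`!).-1.+1 = r`! by rewrite prednK ?fact_gt0.
have [b|w wP] := @boolp.choice _ _ (fun (b : 'I_r) (w : C) =>
    (0 < blk_size b)%N -> (blk_size b).-primitive_root w).
  have [q0|q0] := posnP (blk_size b); first by exists 0; rewrite q0.
  by have [w pw] := primitive_root_exists R q0; exists w.
have {}wP k : (blk_size (blk k)).-primitive_root (w (blk k)).
  exact/wP/blk_size_gt0.
pose U b s t k l : L := weyl_unit _ (blk_size b) (w b) (blk_pos b s)
  (blk_pos b t) (blk_pos b k) (blk_pos b l).
pose c b : C := (blk_size b)%:R^-1.
have c0 k : (blk_size (blk k))%:R != 0 :> C.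
  by rewrite pnatr_eq0 -lt0n blk_size_gt0.
pose P s t : 'M[L]_n.+1 := \sum_(k | block (blk s) k)
  \sum_(l | block (blk s) l) tens (c (blk s) *: e k l) (U (blk s) s t k l).
have Ustar b s t k l : vn_star (U b s t k l) = U b s t l k.
  exact: weyl_unit_star.
have Umul s t k l l' j : block (blk s) k -> block (blk s) l ->
    block (blk s) l' -> block (blk s) j ->
    U (blk s) s t k l * U (blk s) s t l' j = (l == l')%:R *: U (blk s) s t k j.
  move=> kb lb l'b jb; rewrite -(blk_pos_inj lb l'b).
  by apply: weyl_unit_mul; rewrite ?mE ?blk_size_dvd ?blk_pos_lt.
have Usum k l : blk k = blk l -> \sum_(s | block (blk k) s)
    \sum_(t | block (blk k) t) U (blk k) s t k l =
    ((k == l)%:R * (blk_size (blk k))%:R) *: 1.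
  move=> kl; have kb : blk k == blk k by [].
  have lb : blk l == blk k by rewrite kl.
  rewrite -(blk_pos_inj kb lb) -(weyl_unit_sum _ (wP k)) ?blk_pos_lt //.
  rewrite -(sum_blk_pos (blk k) (fun i => \sum_(t < _) weyl_unit _ _ _ i t _ _)).
  apply: eq_bigr => s _.
  by rewrite -(sum_blk_pos (blk k) (fun i => weyl_unit _ _ _ _ i _ _)).
have PxP s t x : P s t * tens x 1 * P s t = \sum_(k | block (blk s) k)
    \sum_(j | block (blk s) j) tens (c (blk s) ^+ 2 *:
      \sum_(l | block (blk s) l) e k l * x * e l j) (U (blk s) s t k j).
  have -> : P s t * tens x 1 = \sum_(k | block (blk s) k)
      \sum_(l | block (blk s) l) tens (c (blk s) *: e k l * x) (U (blk s) s t k l).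
    rewrite /P mulr_suml; apply: eq_bigr => k _; rewrite mulr_suml.
    by apply: eq_bigr => l _; rewrite tensM mulr1.
  rewrite (tens_units_mul _ _ (@Umul s t)).
  apply: eq_bigr => k _; apply: eq_bigr => j _; congr (tens _ _).
  rewrite scaler_sumr; apply: eq_bigr => l _.
  by rewrite -!scalerAl -scalerAr scalerA expr2.
have PP s t : P s t * P s t = P s t.
  have := PxP s t 1; rewrite tens11 mulr1 => ->.
  apply: eq_bigr => k kb; apply: eq_bigr => j jb; congr (tens _ _).
  rewrite (eq_bigr (fun=> e k j)) => [|l lb]; last first.
    by rewrite mulr1 (mu_mul mu) ?(block_eq kb lb) ?(block_eq lb jb).
  rewrite sumr_const -scaler_nat scalerA /c expr2 -mulrA mulVf ?mulr1 //.
pose f (i : 'I_#|X|) := P (enum_val i).1 (enum_val i).2.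
exists f; split.
- move=> i; apply: in_tensor_sum => k kb; apply: in_tensor_sum => l lb.
  apply: in_tensor_tens; rewrite memvZ //.
  by have /relcommP[] := mu_in mu (block_eq kb lb).
- move=> i; split; first exact: PP.
  rewrite /f /P adjL_sum exchange_big; apply: eq_bigr => l lb.
  rewrite adjL_sum; apply: eq_bigr => k kb.
  rewrite adjL_tens Ustar starZ (mu_star mu); congr (tens (_ *: _) _).
  by rewrite fmorphV /= conjC_nat.
- rewrite /f -(big_enum_val (A := X) (fun st => P st.1 st.2)) /=.
  pose T k l s t := tens (c (blk k) *: e k l) (U (blk k) s t k l).
  transitivity (\sum_k \sum_(l | block (blk k) l) \sum_(s | block (blk k) s)
      \sum_(t | block (blk k) t) T k l s t).
    transitivity (\sum_s \sum_(t | block (blk s) t) P s t).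
      rewrite [RHS]pair_big_dep /=; apply: eq_big => [[s t]|[s t] _] //=.
    rewrite (eq_bigr (fun s => \sum_(k | block (blk s) k)
        \sum_(l | block (blk k) l) \sum_(t | block (blk k) t) T k l s t)).
      rewrite (exchange_big_dep xpredT) //=; apply: eq_bigr => k _.
      rewrite exchange_big; apply: eq_bigr => l _ /=.
      by apply: eq_bigl => s; rewrite eq_sym.
    move=> s _; rewrite exchange_big; apply: eq_bigr => k /eqP kb.
    by rewrite exchange_big /T kb.
  rewrite -[RHS]/(1 : 'M[L]_n.+1) -tens11 -(mu_sum mu) tens_suml; apply: eq_bigr => k _.
  transitivity (\sum_(l | block (blk k) l) tens (c (blk k) *: e k l)
      (((k == l)%:R * (blk_size (blk k))%:R) *: 1 : L)).
    apply: eq_bigr => l /eqP lk; rewrite -(Usum k l) //.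
    apply: esym; exact: (@tens_sumr2 R n L).
  rewrite (bigD1 k) //= eqxx mul1r -tens_scale scalerA mulfV // scale1r.
  rewrite big1 ?addr0 // => l /andP[_ nlk].
  by rewrite eq_sym (negPf nlk) mul0r scale0r tens0r.
move=> i x xN xo; rewrite -[_ *m _ *m _]/(P _ _ * _ * P _ _) PxP.
rewrite big1 // => k kb; rewrite big1 // => j jb.
by rewrite -spread_unit // spread_orthogonal // mul0r scaler0 tens0l.
Qed.
End BlockColouring.

(** * Extending a trace from a subalgebra *)

(** The hypotheses say that the values of a positive functional at the squares of [1 + x]
    and of [1 + 'i *: x] are real; [a], [b], [p] stand for its values at [x], at the
    adjoint of [x], and at their product. *)
Lemma conj_of_real_polarization (C : numClosedFieldType) (a b p : C) : p^* = p ->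
  (1 + 1 * a + (1^* * b + 1^* * 1 * p))^* = 1 + 1 * a + (1^* * b + 1^* * 1 * p) ->
  (1 + 'i * a + ('i^* * b + 'i^* * 'i * p))^* =
    1 + 'i * a + ('i^* * b + 'i^* * 'i * p) -> b = a^*.
Proof.
move=> pR; rewrite !rmorphD !rmorphM /= !rmorph1 !conjCK conjCi pR => h1 h2.
have h3 : 'i * (b^* - a^*) = 'i * (a - b).
  apply: (addrI (1 + 'i * - 'i * p)); rewrite /= in h1 h2.
  by transitivity (1 + - 'i * a^* + ('i * b^* + 'i * - 'i * p));
    [ring | rewrite h2; ring].
have {}h3 := mulfI (neq0Ci C) h3.
have h4 : a^* + b^* = a + b.
  apply: (addrI (1 + p)).
  by transitivity (1 + 1 * a^* + (1 * b^* + 1 * 1 * p)); [ring | rewrite h1; ring].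
apply: (can_inj (@conjCK C)); rewrite conjCK.
have n2 : 2%:R != 0 :> C by rewrite pnatr_eq0.
apply: (mulfI n2); transitivity ((a^* + b^*) + (b^* - a^*)); first by ring.
by rewrite h3 h4; ring.
Qed.

Section Subalgebra.
Variables (R : realType) (n : nat) (M : fdVNA R n).
Local Notation C := R[i].
Local Notation Mx := 'M[C]_n.+1.
Local Notation Ms := (subvs_of M).

Lemma val_mulM (x y : Ms) : vsval (x * y) = vsval x * vsval y.
Proof. by []. Qed.

Lemma val_oneM : vsval (1 : Ms) = 1.
Proof. by apply/eqP; rewrite algid_eq1 fd_one. Qed.

Lemma val_starM (x : Ms) : vsval (starM x) = (vsval x) ^t*.
Proof. by rewrite vsprojK // fd_star // subvsP. Qed.

Variable tau : {scalar Ms}.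

Fact extend_linear : linear (fun x => tau (vsproj M x) : C^o).
Proof. by move=> a x y; rewrite !linearP. Qed.

Definition extend : {scalar Mx} :=
  HB.pack (fun x => tau (vsproj M x) : C^o)
    (GRing.isLinear.Build _ _ _ _ _ extend_linear).

Lemma extendE (x : Ms) : extend (vsval x) = tau x.
Proof. by rewrite /= vsvalK. Qed.

Lemma l2dotE (x y : Ms) : l2dot tau x y = extend ((vsval y) ^t* * vsval x).
Proof. by rewrite /l2dot -extendE val_mulM val_starM. Qed.

(** The compatibility with adjoints follows from positivity by polarisation. *)
Lemma extend_faithful : faithful_tracial_state tau -> faithful_trace M extend.
Proof.
move=> [t1 tpos tfaith tcomm].
have pos x : x \in M -> 0 <= extend (x ^t* * x).
  by move=> xM; have := tpos (vsproj M x); rewrite l2dotE vsprojK.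
split=> //.
- move=> x xM; have real y : y \in M ->
      (extend (y ^t* * y))^* = extend (y ^t* * y).
    by move=> yM; apply/CrealP/ger0_real/pos.
  have e1 : extend 1 = 1 by rewrite -val_oneM extendE.
  have exp (a : C) : extend ((1 + a *: x) ^t* * (1 + a *: x)) =
      1 + a * extend x + (a^* * extend (x ^t*) + a^* * a * extend (x ^t* * x)).
    rewrite starD star1 starZ mulrDl mul1r mulrDr mulr1 -scalerAl -scalerAr.
    by rewrite scalerA !linearD !scalarZ e1.
  have h1 := real (1 + 1 *: x); have h2 := real (1 + 'i *: x).
  apply: (conj_of_real_polarization (real x xM)).
    by rewrite -exp h1 // memvD ?fd_one ?memvZ.
  by rewrite -exp h2 // memvD ?fd_one ?memvZ.
- move=> x xM; have := tfaith (vsproj M x).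
  by rewrite l2dotE vsprojK // => h /h /(congr1 vsval); rewrite vsprojK.
- move=> x y xM yM; have := tcomm (vsproj M x) (vsproj M y).
  by rewrite -!extendE !val_mulM !vsprojK.
Qed.
End Subalgebra.

Opaque extend.

(** * The index of a Markov trace *)
Section IndexOfMarkovTrace.
Variables (R : realType) (n : nat) (N M : fdVNA R n) (sNM : (N <= M)%VS).
Hypothesis fN : is_factor N.
Local Notation C := R[i].
Local Notation Mx := 'M[C]_n.+1.
Local Notation Ms := (subvs_of M).
Local Notation Q := (relcomm N M).
Variables (tau : {scalar Ms}) (e : 'End(Ms)).
Hypothesis tauP : faithful_tracial_state tau.
Hypothesis eP : jones_projection N tau e.
Implicit Types (x y q : Mx).

Let t := extend tau.
Let tM : faithful_trace M t := extend_faithful tauP.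
Let E x : Mx := vsval (e (vsproj M x)).

Let EN x : E x \in N. Proof. exact: (proj1 eP). Qed.

Let Eortho x y : x \in M -> y \in N -> t (y ^t* * (x - E x)) = 0.
Proof.
move=> xM yN; have yM := subvP sNM _ yN.
have := proj2 eP (vsproj M x) (vsproj M y); rewrite vsprojK // => /(_ yN).
by rewrite l2dotE vsprojK // linearB /= vsprojK.
Qed.

Let Euniq x w : x \in M -> w \in N ->
  (forall y, y \in N -> t (y ^t* * (x - w)) = 0) -> E x = w.
Proof.
move=> xM wN wo; apply/eqP; rewrite -subr_eq0; apply/eqP.
have dN : E x - w \in N by rewrite memvB.
apply: (ftr_eq0 tM (subvP sNM _ dN)).
have {2}-> : E x - w = (x - w) - (x - E x).
  by rewrite opprB [RHS]addrC addrA subrK.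
by rewrite mulrBr linearB wo // Eortho // subrr.
Qed.

Let EMl a x : a \in N -> x \in M -> E (a * x) = a * E x.
Proof.
move=> aN xM; have aM := subvP sNM _ aN.
apply: Euniq; rewrite ?fdM // => y yN.
have -> : y ^t* * (a * x - a * E x) = (a ^t* * y) ^t* * (x - E x).
  by rewrite starM_mx trmxCK -mulrBr mulrA.
by rewrite Eortho // fdM // fd_star.
Qed.

Let EMr a x : a \in N -> x \in M -> E (x * a) = E x * a.
Proof.
move=> aN xM; have aM := subvP sNM _ aN.
apply: Euniq; rewrite ?fdM // => y yN; have yM := subvP sNM _ yN.
have ExM : x - E x \in M by rewrite memvB // (subvP sNM).
rewrite -mulrBl mulrA (ftr_comm tM) ?fdM ?fd_star // mulrA.
rewrite -[a * _]trmxCK starM_mx trmxCK Eortho // fdM // fd_star //.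
Qed.

Let E_relcomm q : q \in Q -> E q = t q *: 1.
Proof.
move=> /relcommP[qM /centvP qN].
have [|s Es] := factor_scalar fN (EN q).
  by apply/commutantP => a aN; rewrite -EMr // qN // EMl.
have := Eortho qM (fd_one N); rewrite star1 mul1r Es linearB scalarZ.
have -> : t 1 = 1 by rewrite -(val_oneM M) /t extendE; case: tauP.
by rewrite mulr1 => /eqP; rewrite subr_eq0 => /eqP <-.
Qed.

(** [E] is the conditional expectation of [M] onto [N].  It is bimodular over [N], and
    it is the trace on the relative commutant, because its values there are central in
    [N].  So the identity is the frame expansion there, and [N] together with the relative
    commutant generates [M]. *)
Lemma relcomm_resolution o : frame t Q o -> forall x, x \in M ->
  x = \sum_(f <- o) f * E (f ^t* * x).
Proof.
move=> [oQ oE] x xM; have tN := mxtrace_faithful N.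
have [g fg] := frame_exists tN (subvv N).
have [a xE] := factor_resolution fN fg.
have ED y z : E (y + z) = E y + E z by rewrite /E !linearD.
have EZ c y : E (c *: y) = c *: E y by rewrite /E !linearZ.
(* The resolution of the factor reduces the claim to products [b * y] with [b] in
   [N] and [y] in the relative commutant. *)
pose F y := \sum_(f <- o) f * E (f ^t* * y).
have FD y z : F (y + z) = F y + F z.
  rewrite /F -big_split; apply: eq_bigr => f _ /=.
  by rewrite -mulrDr -ED -mulrDr.
have FZ c y : F (c *: y) = c *: F y.
  rewrite /F scaler_sumr; apply: eq_bigr => f _ /=.
  by rewrite -scalerAr EZ -scalerAr.
have F0 : F 0 = 0 by have := FZ 0 0; rewrite !scale0r.
suff FgE b : b \in g -> F (b * twirl g (b ^t* * x)) = b * twirl g (b ^t* * x).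
  rewrite -/(F x) (xE x) FZ (big_morph F FD F0); congr (_ *: _).
  by apply: eq_big_seq => b /FgE.
move=> /(proj1 fg) bN; have bM := subvP sNM _ bN.
have : twirl g (b ^t* * x) \in Q.
  apply/relcommP; split; last exact: twirl_cent tN fg.
  apply: (twirl_in sNM); first exact: (proj1 fg).
  by rewrite fdM ?fd_star.
move: (twirl g _) => y yQ; rewrite /F [in RHS](oE y) // mulr_sumr; apply: eq_big_seq => f fo.
have fQ := oQ f fo; have fsQ : f ^t* \in Q := fd_star fQ.
have /relcommP[fsM /centvP fsN] := fsQ; have /relcommP[fM /centvP fN'] := fQ.
have /relcommP[yM _] := yQ.
rewrite mulrA fsN // -mulrA EMl ?fdM // E_relcomm ?fdM //.
by rewrite -!scalerAr mulr1 fN'.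
Qed.

Lemma amullE (x y : Ms) : amull x y = x * y.
Proof. by rewrite lfunE. Qed.

(** A frame of the relative commutant is a Pimsner--Popa basis of [M] over [N]. *)
Lemma relcomm_index_family o : frame t Q o ->
  index_family e (fun i : 'I_(size o) => vsproj M ((o`_i) ^t*)).
Proof.
move=> fo; apply/lfunP => z; rewrite id_lfunE sum_lfunE.
apply: subvs_inj; rewrite (relcomm_resolution fo (subvsP z)).
rewrite (big_nth 0) big_mkord linear_sum /=; apply: eq_bigr => i _.
have /(proj1 fo)/relcommP[oiM _] := mem_nth 0 (ltn_ord i).
have osM : o`_i ^t* \in M by rewrite fd_star.
rewrite !comp_lfunE !amullE val_mulM val_starM vsprojK // trmxCK.
congr (_ * vsval (e _)); apply: subvs_inj.
by rewrite val_mulM !vsprojK // fdM ?subvsP.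
Qed.

(** Multiplying the identity [\sum_i lam_i^* e lam_i = 1] by [x] and applying [tr1] gives
    [tau (s * x) = c * tau x], where [s] is the sum and [c] is [tr1 \1]; faithfulness
    of [tau] then forces [s] to be [c *: 1]. *)
Lemma index_family_value (tr1 : {scalar 'End(Ms)}) k (lam : 'I_k -> Ms) :
  canonical_trace tau e tr1 -> tr1 \1%VF != 0 ->
  (forall x : Ms, tr1 (amull x) / tr1 \1%VF = tau x) -> index_family e lam ->
  \sum_i starM (lam i) * lam i = tr1 \1%VF *: 1.
Proof.
move=> [_ _ tr1E] tr0 tr1tau fam; have [_ _ faith comm] := tauP.
set s := \sum_i _; set c := tr1 _ in tr0 tr1tau *.
have sE (x : Ms) : tau (s * x) = c * tau x.
  rewrite -(tr1tau x) mulrC divfK //.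
  have -> : amull x = (\sum_i
      (amull (starM (lam i)) \o e \o amull (lam i * x)))%VF.
    have := congr1 (fun f => f \o amull x)%VF fam.
    rewrite comp_lfun1l => <-; apply/lfunP => z.
    rewrite comp_lfunE !sum_lfunE; apply: eq_bigr => i _.
    by rewrite !comp_lfunE !amullE mulrA.
  rewrite linear_sum /s mulr_suml linear_sum; apply: eq_bigr => i _ /=.
  by rewrite tr1E mulrA.
apply/eqP; rewrite -subr_eq0; apply/eqP; apply: faith.
by rewrite /l2dot comm mulrBl linearB /= sE -scalerAl mul1r scalarZ subrr.
Qed.

(** The value does not depend on the family, by [index_family_value], so it can be read off
    from the family given by a frame of the relative commutant. *)
Lemma markov_index h d : frame (@mxtrace C n.+1) Q h ->
  \sum_(b <- h) \tr (b ^t* * b) = d -> markov_trace N tau e ->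
  (exists k (lam : 'I_k -> Ms), index_family e lam) /\
  forall k (lam : 'I_k -> Ms), index_family e lam ->
    \sum_i starM (lam i) * lam i = d *: 1.
Proof.
move=> fh hd [_ _ [tr1 [can1 tr10 tr1tau]]].
have QM : (Q <= M)%VS := capvSl _ _.
have [o fo] := frame_exists tM QM.
have ofam := relcomm_index_family fo.
have val := index_family_value can1 (lt0r_neq0 tr10) tr1tau.
split; first by exists (size o); eexists; exact: ofam.
move=> k lam /val ->; congr (_ *: _).
have := congr1 tau (val _ _ ofam); rewrite linear_sum scalarZ.
have [-> _ _ _] := tauP; rewrite mulr1 => <-.
rewrite -hd (frame_size fh fo) (big_nth 0) big_mkord; apply: eq_bigr => i _.
have /(proj1 fo)/relcommP[oiM _] := mem_nth 0 (ltn_ord i).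
have osM : o`_i ^t* \in M by rewrite fd_star.
rewrite -[LHS]extendE val_mulM val_starM vsprojK // trmxCK.
exact: ftr_comm tM _ _ oiM osM.
Qed.
End IndexOfMarkovTrace.

(** * Existence of a Markov trace *)
Section MarkovTraceExists.
Variables (R : realType) (n : nat) (N M : fdVNA R n) (sNM : (N <= M)%VS).
Hypothesis fN : is_factor N.
Local Notation C := R[i].
Local Notation Mx := 'M[C]_n.+1.
Local Notation Ms := (subvs_of M).
Local Notation tr := (@mxtrace C n.+1).
Implicit Types (x y : Mx).

Section RegularTrace.
Variables (g : seq Mx) (fg : frame tr M g).
Let Z := twirl g 1.
Let trM := mxtrace_faithful M.

Let ZC x : x \in M -> x * Z = Z * x.
Proof. exact: twirl_comm trM fg. Qed.

Lemma mxtrace_twirl x : tr (x * Z) = \sum_(b <- g) tr (b ^t* * (x * b)).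
Proof.
rewrite /Z /twirl mulr_sumr (linear_sum tr); apply: eq_bigr => b _ /=.
by rewrite mulr1 [RHS]mxtraceM mulrA.
Qed.

Lemma mxtrace_twirl1_gt0 : 0 < tr Z.
Proof.
rewrite -[Z]mul1r mxtrace_twirl; under eq_bigr do rewrite mul1r.
exact: frame_norm_gt0 trM fg.
Qed.

(** This is the normalised trace of left multiplications on [M], and the Markov trace of
    the inclusion. *)
Lemma regular_trace_exists : exists2 tau : {scalar Ms},
  faithful_tracial_state tau & forall x : Ms, tau x = tr (vsval x * Z) / tr Z.
Proof.
have lin : linear (fun x : Ms => tr (vsval x * Z) / tr Z : C^o).
  move=> a x y; rewrite linearP /= mulrDl -scalerAl linearP /= mulrDl.
  by rewrite -mulrA.
have [tau tauE] : exists tau : {scalar Ms},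
    forall x : Ms, tau x = tr (vsval x * Z) / tr Z.
  pose tau : {scalar Ms} := HB.pack (fun x : Ms => tr (vsval x * Z) / tr Z : C^o)
    (GRing.isLinear.Build _ _ _ _ _ lin).
  by exists tau.
exists tau => //; have Z0 := mxtrace_twirl1_gt0.
have dotE (x : Ms) : l2dot tau x x =
    (\sum_(b <- g) tr ((vsval x * b) ^t* * (vsval x * b))) / tr Z.
  rewrite /l2dot tauE; congr (_ / _).
  have -> : vsval (starM x * x) = (vsval x) ^t* * vsval x.
    by rewrite -val_starM.
  rewrite mxtrace_twirl; apply: eq_bigr => b _; congr (tr _).
  by rewrite starM_mx !mulrA.
split.
- by rewrite tauE val_oneM mul1r divff // gt_eqF.
- move=> x; rewrite dotE divr_ge0 ?(ltW Z0) //.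
  by apply: sumr_ge0 => b _; apply: mxtrace_starM_ge0.
- move=> x; rewrite dotE => /eqP; rewrite mulf_eq0 invr_eq0 (gt_eqF Z0) orbF.
  rewrite psumr_eq0 => [/allP x0|b _]; last exact: mxtrace_starM_ge0.
  apply: subvs_inj; rewrite -[LHS]mulr1 [in LHS](proj2 fg 1) ?fd_one //.
  rewrite mulr_sumr linear0 big_seq big1 // => b bg; rewrite -scalerAr.
  by have /eqP/mxtrace_starM_eq0 -> := x0 _ bg; rewrite scaler0.
- move=> x y; rewrite tauE [RHS]tauE; congr (_ / _).
  transitivity (tr (vsval x * (Z * vsval y))).
    by rewrite -(ZC (subvsP y)) mulrA.
  by rewrite mulrA mxtraceM mulrA.
Qed.
End RegularTrace.

Lemma jones_projection_exists (tau : {scalar Ms}) v :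
  faithful_tracial_state tau -> frame (extend tau) N v ->
  exists2 e, jones_projection N tau e & forall x : Ms,
    vsval (e x) = \sum_(b <- v) extend tau (b ^t* * vsval x) *: b.
Proof.
move=> tauP [vN vE]; have tM := extend_faithful tauP.
pose f (x : Ms) : Ms := vsproj M
  (\sum_(b <- v) extend tau (b ^t* * vsval x) *: b).
have flin : linear f.
  move=> a x y; rewrite /f -linearP; congr (vsproj M _).
  rewrite scaler_sumr -big_split; apply: eq_bigr => b _.
  by rewrite linearP mulrDr -scalerAr linearD scalarZ scalerDl scalerA.
pose e : 'End(Ms) := linfun (HB.pack f (GRing.isLinear.Build _ _ _ _ f flin)
  : {linear Ms -> Ms}).
have sumN x : \sum_(b <- v) extend tau (b ^t* * x) *: b \in N.
  by rewrite big_seq; apply: memv_suml => b bv; rewrite memvZ ?vN.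
have eE (x : Ms) : vsval (e x) = \sum_(b <- v) extend tau (b ^t* * vsval x) *: b.
  by rewrite lfunE /= /f vsprojK // (subvP sNM).
exists e => //; split=> [x|x y yN]; first by rewrite eE.
have -> : l2dot tau (x - e x) y =
    extend tau ((vsval y) ^t* * (vsval x - vsval (e x))).
  by rewrite l2dotE linearB.
rewrite eE mulrBr linearB; apply/eqP; rewrite subr_eq0.
apply/eqP; rewrite {1}(vE _ yN) star_sum mulr_suml mulr_sumr !linear_sum.
apply: eq_big_seq => b /vN bN; have bM := subvP sNM _ bN.
rewrite starZ -scalerAl -scalerAr !scalarZ (ftr_comm_star tM) ?subvsP //.
by rewrite mulrC.
Qed.

(** An endomorphism of [M] seen as a map on all matrices; this allows frames in the
    algebra of all matrices to be used. *)
Definition ambient (T : 'End(Ms)) : {linear Mx -> Mx} :=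
  vsval \o (T \o vsproj M).

Lemma ambient_in T x : ambient T x \in M.
Proof. exact: subvsP. Qed.

Lemma ambient_comp (S T : 'End(Ms)) x :
  ambient (S \o T)%VF x = ambient S (ambient T x).
Proof. by rewrite /= comp_lfunE vsvalK. Qed.

Lemma ambient_amull (x : Ms) y : y \in M -> ambient (amull x) y = vsval x * y.
Proof. by move=> yM; rewrite /ambient /= lfunE /= vsprojK. Qed.

Section FrameTrace.
Variables (tau : {scalar Ms}) (u : seq Mx).
Hypotheses (tauP : faithful_tracial_state tau) (fu : frame (extend tau) M u).
Let t := extend tau.

Definition frame_trace (T : 'End(Ms)) : C^o :=
  \sum_(b <- u) t (b ^t* * ambient T b).

Fact frame_trace_linear : linear frame_trace.
Proof.
move=> a S T; rewrite /frame_trace scaler_sumr -big_split.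
apply: eq_bigr => b _.
have -> : ambient (a *: S + T) b = a *: ambient S b + ambient T b.
  by rewrite /= add_lfunE scale_lfunE linearP.
by rewrite mulrDr -scalerAr linearP.
Qed.

Lemma frame_trace_comm S T : frame_trace (S \o T)%VF = frame_trace (T \o S)%VF.
Proof.
rewrite /frame_trace (eq_bigr _ (fun b _ => congr1 (fun z => t (b ^t* * z))
  (ambient_comp S T b))) (frame_trace_cyclic fu fu) => [|x _|x _].
- by apply: eq_bigr => b _; rewrite ambient_comp.
- exact: ambient_in.
- exact: ambient_in.
Qed.

(** The trace of [T \o S] for the adjoint [T] of [S] is a sum of squared norms
    of the [S b]. *)
Lemma frame_trace_adjoint (S T : 'End(Ms)) :
  (forall x y : Ms, l2dot tau (S x) y = l2dot tau x (T y)) ->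
  0 <= frame_trace (T \o S)%VF.
Proof.
have tM := extend_faithful tauP; have [_ tpos _ _] := tauP.
move=> adj; rewrite /frame_trace big_seq; apply: sumr_ge0 => b /(proj1 fu) bM.
have -> : t (b ^t* * ambient (T \o S)%VF b) =
    l2dot tau (T (S (vsproj M b))) (vsproj M b).
  by rewrite l2dotE vsprojK // ambient_comp /= vsvalK.
have conj (x y : Ms) : (l2dot tau x y)^* = l2dot tau y x.
  by rewrite !l2dotE (ftr_comm_star tM) ?subvsP.
by rewrite -conj -adj conj_ge0 tpos.
Qed.

Lemma frame_trace_id : frame_trace \1%VF = \sum_(b <- u) t (b ^t* * b).
Proof.
by apply: eq_big_seq => b /(proj1 fu) bM; rewrite /ambient /= id_lfunE vsprojK.
Qed.

Lemma frame_trace_amull g (x : Ms) : frame tr M g ->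
  frame_trace (amull x) = tr (vsval x * twirl g 1).
Proof.
move=> fg; rewrite mxtrace_twirl /frame_trace (frame_trace_eq (S := ambient (amull x)) fu fg).
  by apply: eq_big_seq => b /(proj1 fg) bM; rewrite ambient_amull.
by move=> y _; apply: ambient_in.
Qed.

(** By cyclicity this is the trace of the compression of a left multiplication to [N],
    that is [tau] of [y * x * twirl v 1]; and [twirl v 1] is a scalar as [N] is a
    factor. *)
Lemma frame_trace_jones v (e : 'End(Ms)) (x y : Ms) : frame t N v ->
  (forall z : Ms, vsval (e z) = \sum_(b <- v) t (b ^t* * vsval z) *: b) ->
  frame_trace (amull x \o e \o amull y)%VF =
    (\sum_(b <- v) t (b ^t* * b)) * tau (x * y).
Proof.
move=> fv eE; have tM := extend_faithful tauP; have [t1 _ _ tcomm] := tauP.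
have tN := faithful_traceS sNM tM.
have vM b : b \in v -> b \in M by move=> /(proj1 fv)/(subvP sNM).
set d := \sum_(b <- v) _.
have twE : twirl v 1 = d *: 1.
  have [||s sE] := @factor_scalar _ _ N (twirl v 1) fN.
  - apply: (twirl_in (subvv N)) (fd_one N); exact: (proj1 fv).
  - exact: twirl_cent tN fv.
  rewrite sE; congr (_ *: _).
  have := congr1 t sE; rewrite scalarZ.
  have -> : t 1 = 1 by rewrite -(val_oneM M) /t extendE.
  rewrite mulr1 => <-; rewrite /twirl linear_sum; apply: eq_big_seq => b bv.
  by rewrite mulr1 (ftr_comm tM) ?fd_star ?vM.
rewrite -comp_lfunA frame_trace_comm -comp_lfunA.
have -> : (amull y \o amull x = amull (y * x))%VF by rewrite amullM.
have ExpE b : b \in u -> t (b ^t* * ambient (e \o amull (y * x))%VF b) =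
    \sum_(c <- v) t (b ^t* * c) * t (c ^t* * vsval (y * x) * b).
  move=> /(proj1 fu) bM; rewrite ambient_comp ambient_amull //.
  rewrite -[ambient e _]/(vsval (e (vsproj M _))) eE vsprojK ?fdM ?subvsP //.
  rewrite mulr_sumr linear_sum; apply: eq_bigr => c _.
  by rewrite -scalerAr scalarZ mulrC mulrA.
rewrite /frame_trace (eq_big_seq _ ExpE) exchange_big /=.
transitivity (\sum_(c <- v) t (c ^t* * vsval (y * x) * c)).
  apply: eq_big_seq => c /vM cM.
  rewrite [X in _ = t (_ * X)](proj2 fu c) //.
  rewrite mulr_sumr linear_sum; apply: eq_bigr => b _.
  by rewrite -scalerAr scalarZ.
transitivity (t (vsval (y * x) * twirl v 1)).
  rewrite /twirl mulr_sumr linear_sum; apply: eq_big_seq => c /vM cM.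
  have csM : c ^t* \in M by rewrite fd_star.
  have zM : vsval (y * x) \in M by rewrite subvsP.
  by rewrite mulr1 -mulrA (ftr_comm tM csM (fdM zM cM)) mulrA.
by rewrite twE -scalerAr mulr1 scalarZ /t extendE tcomm.
Qed.
End FrameTrace.

(** The canonical trace of the basic construction is the trace of endomorphisms of [M]
    divided by the dimension of [N].  Its values at left multiplications can be
    computed in a frame for the matrix trace, which gives back [tau]. *)
Lemma markov_trace_exists : exists tau e, markov_trace (M := M) N tau e.
Proof.
have trM := mxtrace_faithful M.
have [g fg] := frame_exists trM (subvv M).
have [tau tauP tauE] := regular_trace_exists fg.
have tM := extend_faithful tauP.
have tN := faithful_traceS sNM tM.
have [u fu] := frame_exists tM (subvv M).
have [v fv] := frame_exists tM sNM.
have [e eP eE] := jones_projection_exists tauP fv.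
pose d := \sum_(b <- v) extend tau (b ^t* * b).
have d0 : 0 < d := frame_norm_gt0 tN fv.
have tr1_lin : linear (fun T => d^-1 * frame_trace tau u T : C^o).
  by move=> a S T; rewrite frame_trace_linear mulrDr mulrCA.
pose tr1 : {scalar 'End(Ms)} :=
  HB.pack (fun T => d^-1 * frame_trace tau u T : C^o)
    (GRing.isLinear.Build _ _ _ _ _ tr1_lin).
have tr1E T : tr1 T = d^-1 * frame_trace tau u T by [].
have trid : 0 < frame_trace tau u \1%VF.
  by rewrite (frame_trace_id fu) (frame_norm_gt0 tM fu).
exists tau, e; split=> //; exists tr1; split; first split.
- by move=> S T _ _; rewrite !tr1E (frame_trace_comm fu).
- move=> S T _ _ adj; rewrite tr1E mulr_ge0 ?invr_ge0 ?(ltW d0) //.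
  exact: (frame_trace_adjoint tauP fu).
- move=> x y; rewrite tr1E (frame_trace_jones tauP fu x y fv eE).
  by rewrite mulKf // gt_eqF.
- by rewrite tr1E mulr_gt0 ?invr_gt0.
move=> x; rewrite !tr1E invfM invrK mulrACA mulVf ?gt_eqF // mul1r.
rewrite (frame_trace_amull fu x fg) tauE; congr (_ / _).
by rewrite -amull1 (frame_trace_amull fu 1 fg) val_oneM mul1r.
Qed.
End MarkovTraceExists.

(** * Chromatic numbers and index *)

Theorem theorem5p7 (R : realType) (n : nat) (N M : fdVNA R n)
    (sNM : (N <= M)%VS) (factorN : is_factor N) :
  exists c : nat,
    [/\ is_chi_q (commutant_graph sNM) c,
        is_chi_qc (commutant_graph sNM) c
      & is_index N M c%:R].
Proof.
have [r [blk [e mu]]] := matrix_units_exist (relcomm N M).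
have [h fh hsize] := matrix_units_frame mu.
exists #|[pred kl | blk kl.1 == blk kl.2]|.
have [m col] := bell_colouring sNM factorN mu.
have low c' (L : tracialVNA R) : colourable (commutant_graph sNM) L c' ->
    (#|[pred kl | blk kl.1 == blk kl.2]| <= c')%N.
  by move=> /(colouring_lower_bound factorN fh); rewrite hsize ler_nat.
split.
- split; first by exists (mx_tva R m); split; first exact: mx_findim.
  by move=> c' [L [_ /low]].
- by split; [exists (mx_tva R m) | move=> c' [L /low]].
split; first exact: markov_trace_exists sNM factorN.
move=> tau e' mk; have [tauP eP _] := mk.
rewrite rmorph_nat; exact (markov_index sNM factorN tauP eP fh hsize mk).
Qed.
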